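(* Let $\kappa$ be an infinite cardinal, $\sigma\le\kappa$, and let $\{X_\alpha\}_{\alpha<\sigma}$ be a family of topological spaces with $\mathrm{gd}(X_\alpha)\le\kappa$ for all $\alpha<\sigma$. Suppose that the following tightness condition holds: for each finite non-empty subset $\Gamma\subset\sigma$ and each non-empty open subset $U\subset\prod_{\gamma\in\Gamma}X_\gamma$ there is a family $\{V_\beta\}_{\beta<\kappa}$ of open subsets of $\prod_{\gamma\in\Gamma}X_\gamma$ such that, whenever $A\subset\prod_{\gamma\in\Gamma}X_\gamma$ is such that for all $\beta<\kappa$ and all $\gamma\in\Gamma$ $$\overline{\pi_{X_\gamma}(A\cap V_\beta)}=\overline{\pi_{X_\gamma}(V_\beta)},$$ then there is $\gamma\in\Gamma$ such that $$\pi_{X_\gamma}(U\setminus\overline{A})\subsetneq\pi_{X_\gamma}(U).$$ Then $\mathrm{gd}\left(\prod_{\alpha<\sigma}X_\alpha\right)\le\kappa$.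
   Context: Products carry the product topology; $\pi_{X_\gamma}$ denotes the natural projection of a product onto its coordinate space $X_\gamma$. For a space $T$, $\mathrm{gd}(T)$ is the least infinite cardinal $\kappa$ such that Player I has a winning strategy in the game $G_{T,\kappa^+}$ defined below. The game $G_{T,\theta}$ ($T$ a topological space, $\theta$ an infinite ordinal) is the following two-player game of perfect information. The game advances in stages indexed by ordinals. At each stage $\alpha$, Player I chooses a non-empty open set $U_\alpha\subset T$ and then Player II chooses a point $x_\alpha\in U_\alpha$. The game ends at the (first) stage $\beta$ with $\overline{\{x_\alpha:\alpha<\beta\}}=T$. Player I wins if the game ends at a stage $\beta<\theta$; otherwise Player II wins. At each stage both players know the stage and the whole history of the game, and strategies may depend on these. *)

(* Defs.v *)
From mathcomp Require Import all_boot.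
From mathcomp Require Import mathcomp_extra boolp classical_sets functions cardinality wochoice.
From mathcomp Require Import topology.

Set Implicit Arguments.
Unset Strict Implicit.
Unset Printing Implicit Defensive.

Local Open Scope classical_set_scope.
Local Open Scope card_scope.

(* A cardinal is represented by any type having that cardinality; cardinals
   are compared with [#<=] (existence of an injection). *)
Definition cardinal := Type.

Definition infinite_cardinal (k : cardinal) : Prop := infinite_set [set: k].

Definition card_leq (k l : cardinal) : Prop := [set: k] #<= [set: l].

(* An ordinal is represented by a well-ordered type: the elements of the type
   stand for the smaller ordinals. *)
Record ordnum := Ordnum {
  stage :> Type;
  ole : rel stage;
  ole_well_order : well_order ole }.

Definition olt (theta : ordnum) (a b : theta) : Prop := ole a b /\ a <> b.

(* [theta] has the order type of the cardinal k^+, the least ordinal that does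
   not inject into k. *)
Definition is_succ_card (k : cardinal) (theta : ordnum) : Prop :=
  ~ card_leq theta k /\ forall a : theta, [set b | olt b a] #<= [set: k].

Section Game.
Variables (T : topologicalType) (theta : ordnum).

(* The moves (U_b, x_b) made at the stages b < a. *)
Definition history (a : theta) : Type := {b : theta | olt b a} -> set T * T.

(* The points played before stage a are dense. This property is preserved when
   a grows, so its negation says that the game has not ended at any stage
   b <= a, i.e. that moves are made at stage a. *)
Definition over (a : theta) (h : history a) : Prop :=
  closure (range (fun b => (h b).2)) = [set: T].

Definition legal_history (a : theta) (h : history a) : Prop :=
  forall b, [/\ open (h b).1, (h b).1 !=set0 & (h b).1 (h b).2].

Definition strategyI : Type := forall a : theta, history a -> set T.

Definition legal_strategyI (s : strategyI) : Prop :=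
  forall (a : theta) (h : history a), legal_history h -> ~ over h ->
    open (s a h) /\ s a h !=set0.

(* A play, padded with arbitrary values from the stage where the game ends (if
   there is one). On an empty space there is no such function, in accordance
   with the fact that the game ends there at stage 0, with Player I winning. *)
Definition play : Type := theta -> set T * T.

Definition past (p : play) (a : theta) : history a := fun b => p (sval b).
Arguments past : clear implicits.

Definition ends_at (p : play) (b : theta) : Prop :=
  over (past p b) /\ forall a, olt a b -> ~ over (past p a).

Definition winsI (p : play) : Prop := exists b : theta, ends_at p b.

(* Player I plays by [s], Player II plays any legal points. *)
Definition play_of (s : strategyI) (p : play) : Prop :=
  forall a, ~ over (past p a) ->
    (p a).1 = s a (past p a) /\ (p a).1 (p a).2.

Definition winning_strategyI (s : strategyI) : Prop :=
  legal_strategyI s /\ forall p, play_of s p -> winsI p.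

Definition has_winning_strategyI : Prop := exists s, winning_strategyI s.

End Game.

Arguments past {T theta} p a _.

(* Player I has a winning strategy in the game on T of length k^+. *)
Definition winsI_succ (T : topologicalType) (k : cardinal) : Prop :=
  exists theta : ordnum, is_succ_card k theta /\ has_winning_strategyI T theta.

Definition is_gd (T : topologicalType) (k : cardinal) : Prop :=
  [/\ infinite_cardinal k,
      winsI_succ T k
    & forall l : cardinal, infinite_cardinal l -> winsI_succ T l ->
        card_leq k l].

Definition gd_le (T : topologicalType) (k : cardinal) : Prop :=
  exists l : cardinal, is_gd T l /\ card_leq l k.

Definition product (I : Type) (X : I -> topologicalType) : topologicalType :=
  prod_topology X.

Definition subproduct (I : Type) (X : I -> topologicalType) (G : set I) :
    topologicalType :=
  product (fun g : G => X (set_val g)).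

Definition tightness_condition (k : cardinal) (I : Type)
    (X : I -> topologicalType) : Prop :=
  forall G : set I, finite_set G -> G !=set0 ->
  forall U : set (subproduct X G), open U -> U !=set0 ->
  exists V : k -> set (subproduct X G),
    (forall b : k, open (V b)) /\
    forall A : set (subproduct X G),
      (forall (b : k) (g : G),
         closure (proj g @` (A `&` V b)) = closure (proj g @` V b)) ->
      exists g : G, proj g @` (U `\` closure A) `<` proj g @` U.

(* Main.v *)
From HB Require Import structures.
From mathcomp Require Import all_boot.
From mathcomp Require Import mathcomp_extra boolp classical_sets functions cardinality wochoice.
Require Import Defs.
From mathcomp Require Import topology.

Set Implicit Arguments.
Unset Strict Implicit.
Unset Printing Implicit Defensive.
Local Open Scope classical_set_scope.
Local Open Scope card_scope.

(** Player I wins on the product by making the points played so far dense in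
    each finite subproduct in turn. There are at most [k] of those, and the
    successor of [k] is regular, so it is enough to treat one finite
    subproduct.

    Call a property of the set of played points forced when Player I, starting
    at any stage, can bring it about before the game of length [k]^+ is over.
    The main tool is [forces_winnable]: if Player I wins a game on a space [T],
    and if for each open set [O] of [T] it can be forced that some [y] in [O]
    has a monotone property [R y], then it can be forced that the [y] with [R y]
    are dense in [T]. Player I runs the game on [T] in the imagination, and
    obtains each answer of the opponent by forcing [R y] for some [y] in the
    open set that the winning strategy prescribes. In particular, coordinatewise
    density in [k] given open sets is forced, and so the tightness condition
    yields: for each open [U] it is forced that some slice of [U], the points of
    [U] with a prescribed coordinate, lies in the closure of the played points.
    Which coordinate it is cannot be chosen, and this is the difficulty.

    Call [U] evasive in coordinate [j] if coordinatewise density in [k] given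
    open sets never suffices to cover a slice in coordinate [j]. If no part
    [U `&` [set u | O (u j)]] is evasive in [j], then slices in coordinate [j]
    can be forced everywhere, and [forces_winnable] fills [U]. Suppose that the
    finite product cannot be filled. The union of the open sets that can be
    filled can itself be filled, so some nonempty open [W] has no nonempty open
    part that can be filled; inside [W] each open set becomes evasive in any
    given coordinate after this coordinate has been restricted to a dense open
    set ([evasive_dense]). Let [B] be a box inside [W].

    If two factors of [B] contain no irreducible open set (one in which any two
    nonempty open sets meet), they contain as many disjoint open sets as needed,
    and these cut out of [B] a finite grid of disjoint cells. Make each cell
    evasive in one coordinate, its colour, so that every value of every
    coordinate is taken in a cell of that colour. The sets that witness evasion
    in the cells are glued into one set ([merge]) that contradicts the tightness
    condition for the union of the cells ([no_grid]).

    Otherwise all factors of [B] but one can be taken irreducible. In an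
    irreducible factor a slice over an open subset is dense in the slice over
    the whole factor, so a slice that has been covered in whatever coordinate is
    progress that does not depend on the current positions in the other
    imagined games, and the games can be run side by side until [B] is filled
    ([no_irreducible_box]). Both cases are absurd. *)

(** * Ordinals and cardinals *)

Lemma card_le_inj (T U : Type) (A : set T) (B : set U) (f : T -> U) :
  (forall x, A x -> B (f x)) ->
  (forall x y, A x -> A y -> f x = f y -> x = y) -> A #<= B.
Proof.
move=> fAB finj; have /injfunPex[g] : exists2 f : T -> U, set_fun A B f & set_inj A f.
  exists f => // x y; rewrite !inE; exact: finj.
exact: inj_card_le.
Qed.

Lemma card_le_fun (T U : Type) (A : set T) (B : set U) (u : U) : A #<= B ->
  exists f : T -> U, (forall x, A x -> B (f x)) /\
    (forall x y, A x -> A y -> f x = f y -> x = y).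
Proof.
pose U' := HB.pack_for pointedType U (gen_eqMixin U) (gen_choiceMixin U)
  (isPointed.Build U u).
move=> /(@pcard_leP T U')/unsquash f; exists f; split; first exact: funS.
by move=> x y Ax Ay; apply: inj; rewrite inE.
Qed.

Lemma card_le_surj (T U : Type) (A : set T) (B : set U) (f : T -> U) :
  (forall y, B y -> exists2 x, A x & f x = y) -> B #<= A.
Proof.
move=> fAB; apply: card_le_trans (card_image_le f A).
by apply: subset_card_le => y /fAB.
Qed.

Section OrdinalNumbers.
Variable W : ordnum.
Implicit Types a b c : W.

Lemma ole_least (P : set W) : P !=set0 ->
  exists m, P m /\ forall n, P n -> ole m n.
Proof.
move=> [a Pa]; have [] := @ole_well_order W (fun x => `[<P x>]).
  by exists a; apply/asboolP.
move=> m [[/asboolP Pm mP] _]; exists m; split=> // n Pn.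
by apply: mP; apply/asboolP.
Qed.

Lemma ole_refl a : ole a a.
Proof. by have [m [-> /(_ a)]] := @ole_least [set a] (ex_intro _ a erefl); apply. Qed.

Lemma ole_total a b : ole a b \/ ole b a.
Proof.
have [] := @ole_least [set x | x = a \/ x = b]; first by exists a; left.
by move=> m [[->|->] h]; [left; apply: h; right|right; apply: h; left].
Qed.

Lemma ole_anti a b : ole a b -> ole b a -> a = b.
Proof.
move=> ab ba; have [] := @ole_well_order W (fun x => `[<x = a \/ x = b>]).
  by exists a; apply/asboolP; left.
move=> m [_ mU]; transitivity m.
  by apply/esym/mU; split=> [|x /asboolP[->|->]];
    [apply/asboolP; left|exact: ole_refl|].
by apply/mU; split=> [|x /asboolP[->|->]];
  [apply/asboolP; right| |exact: ole_refl].
Qed.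

Lemma oltNge a b : olt a b <-> ~ ole b a.
Proof.
split=> [[ab nab ba]|nba]; first by apply: nab; exact: ole_anti.
have [ab|//] := ole_total a b; split=> // e; apply: nba.
by rewrite e; exact: ole_refl.
Qed.

Lemma ole_trans a b c : ole a b -> ole b c -> ole a c.
Proof.
move=> ab bc; have [] := @ole_least [set x | [\/ x = a, x = b | x = c]].
  by exists a; constructor.
move=> m [[->|->|->]]; first by apply; constructor 3.
- by move=> /(_ a (Or31 _ _ erefl)) ba; rewrite (ole_anti ab ba).
move=> /(_ b (Or32 _ _ erefl)) cb; by rewrite -(ole_anti bc cb).
Qed.

Lemma olt_ole_trans a b c : olt a b -> ole b c -> olt a c.
Proof.
by move=> /oltNge ab bc; apply/oltNge => ca; apply: ab; exact: ole_trans ca.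
Qed.

Lemma olt_trans a b c : olt a b -> olt b c -> olt a c.
Proof. by move=> ab [bc _]; exact: olt_ole_trans bc. Qed.

Lemma olt_irr a : ~ olt a a.
Proof. by case. Qed.

Lemma olt_total a b : [\/ olt a b, a = b | olt b a].
Proof.
have [e|ne] := pselect (a = b); first by constructor 2.
by have [ab|ba] := ole_total a b; [constructor 1|constructor 3]; split=> // /esym.
Qed.

Lemma olt_wf : well_founded (@olt W).
Proof.
move=> a; apply: contrapT => na.
have [|m [nm mmin]] := @ole_least [set x | ~ Acc (@olt W) x]; first by exists a.
apply: nm; constructor => b bm; apply: contrapT => /mmin.
by apply/oltNge.
Qed.

(** If no initial segment below [a] exhausts [l], then choosing at each stage a
    point of [l] not chosen before embeds the stages into [l]. *)
Lemma card_le_greedy (l : Type) :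
  [set a : W | ~ ([set: l] #<= [set b | olt b a])] #<= [set: l].
Proof.
have [l0|nl] := pselect (exists x : l, True); last first.
  rewrite (_ : [set a | _] = set0); first exact: card_ge0.
  rewrite predeqE => a; split=> // h; apply: h.
  rewrite (_ : [set: l] = set0); first exact: card_ge0.
  by rewrite predeqE => x; split=> // _; apply: nl; exists x.
case: l0 => l0 _.
pose F a (rec : forall b, olt b a -> l) :=
  xget (l0 : {classic l}) [set y | forall b (h : olt b a), rec b h <> y].
pose g := Fix olt_wf (fun=> l) F.
have gE a : g a = xget (l0 : {classic l}) [set y | forall b, olt b a -> g b <> y].
  rewrite /g Fix_eq // => x f f' ff'; congr F.
  by apply/functional_extensionality_dep => b; exact/funext.
have gfresh a : ~ ([set: l] #<= [set b | olt b a]) ->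
    forall b, olt b a -> g b <> g a.
  move=> na; rewrite [g a]gE.
  have /xgetPex : exists y : {classic l}, forall b, olt b a -> g b <> y; last exact.
  apply: contrapT => ny; apply: na; apply: (@card_le_surj _ _ _ _ g) => y _.
  apply: contrapT => h; apply: ny; exists y => b ba e; apply: h; by exists b.
apply: (@card_le_inj _ _ _ _ g) => // a b na nb gab.
by have [ab|//|ba] := olt_total a b;
  [case: (gfresh b nb a ab)|case: (gfresh a na b ba)].
Qed.

End OrdinalNumbers.

Lemma ordnum_on (T : Type) : exists W : ordnum, stage W = T.
Proof.
have [R wR] := well_ordering_principle {classic T}.
by exists (@Ordnum {classic T} R wR).
Qed.

Lemma card_le_setX (T T' U U' : Type) (A : set T) (A' : set T') (B : set U)
    (B' : set U') :
  A #<= A' -> B #<= B' -> A `*` B #<= A' `*` B'.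
Proof.
have [[a Aa]|nA] := pselect (A !=set0); last first.
  move=> _ _; rewrite (_ : A `*` B = set0) ?card_ge0// predeqE => -[x y].
  by split=> // -[/= Ax _]; apply: nA; exists x.
have [[b Bb]|nB] := pselect (B !=set0); last first.
  move=> _ _; rewrite (_ : A `*` B = set0) ?card_ge0// predeqE => -[x y].
  by split=> // -[/= _ Bx]; apply: nB; exists y.
move=> AA' BB'.
have [[a' _]|nA'] := pselect (exists a' : T', True); last first.
  move: AA'; rewrite (_ : A' = set0); first by move=> /card_le0P A0; move: Aa; rewrite A0.
  by rewrite predeqE => x; split=> // _; apply: nA'; exists x.
have [[b' _]|nB'] := pselect (exists b' : U', True); last first.
  move: BB'; rewrite (_ : B' = set0); first by move=> /card_le0P B0; move: Bb; rewrite B0.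
  by rewrite predeqE => x; split=> // _; apply: nB'; exists x.
have [f [fA finj]] := card_le_fun a' AA'.
have [g [gB ginj]] := card_le_fun b' BB'.
apply: (@card_le_inj _ _ _ _ (fun p => (f p.1, g p.2))).
  by move=> -[x y] [/= Ax By]; split; [exact: fA|exact: gB].
move=> [x y] [x' y'] [/= Ax By] [/= Ax' By'] [ef eg].
by rewrite (finj _ _ Ax Ax' ef) (ginj _ _ By By' eg).
Qed.

(** Shift a sequence of points of [A] by one to make room for [x]. *)
Lemma card_le_setU1 (T : Type) (A : set T) (x : T) :
  infinite_set A -> A `|` [set x] #<= A.
Proof.
move=> /infiniteP iA.
have [xA|xA] := pselect (A x).
  by apply: subset_card_le => y [|->].
have [f [fA finj0]] := card_le_fun x iA.
have finj n m : f n = f m -> n = m by exact: finj0.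
pose pre y := [set n | f n = y].
pose g y := if pselect (y = x) is left _ then f 0%N else
  if pselect (exists n, f n = y) is left h then f (projT1 (cid h)).+1 else y.
have gx y : y = x -> g y = f 0%N by rewrite /g => ->; case: pselect.
have gf n : g (f n) = f n.+1.
  rewrite /g; case: pselect => [e|_]; first by case: xA; rewrite -e; exact: fA.
  case: pselect => [h|]; last by case; exists n.
  by case: (cid h) => m /= /finj ->.
have gid y : y <> x -> (forall n, f n <> y) -> g y = y.
  by rewrite /g => yx yf; case: pselect => // _; case: pselect => // -[n e]; case: (yf n).
have cases y : [\/ y = x, exists n, y = f n | y <> x /\ forall n, f n <> y].
  have [|yx] := pselect (y = x); first by constructor 1.
  have [[n e]|nf] := pselect (exists n, y = f n); first by constructor 2; exists n.
  by constructor 3; split=> // n e; apply: nf; exists n.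
apply: (@card_le_inj _ _ _ _ g) => [y Ay|y z Ay Az].
  have [/gx ->|[n ->]|[yx yf]] := cases y; first exact: fA.
    by rewrite gf; exact: fA.
  by rewrite gid //; case: Ay.
have [ey|[n ->]|[yx yf]] := cases y; have [ez|[m ->]|[zx zf]] := cases z.
- by rewrite ey ez.
- by rewrite gx // gf => /finj.
- by rewrite gx // [g z]gid // => /zf.
- by rewrite gf [g z]gx // => /finj.
- by rewrite !gf => /finj [->].
- by rewrite gf [g z]gid // => /zf.
- by rewrite [g z]gx // [g y]gid // => /esym/yf.
- by rewrite gf [g y]gid // => /esym/yf.
- by rewrite !gid.
Qed.

(** Order the pairs by the larger component, ties being broken by any well-order
    of the pairs. The pairs that precede [p] then have components at most the
    larger component of [p], so [card_le_greedy] applies. *)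
Lemma card_le_sq_step (W : ordnum) (D : set W) :
  (forall m, D m -> ~ (D #<= [set b | ole b m] `*` [set b | ole b m])) ->
  D `*` D #<= D.
Proof.
move=> hD.
have [Q QE] := ordnum_on (W * W).
case: Q QE => Q R0 wR0 /= QE; subst Q.
pose max2 (p : W * W) := if ole p.1 p.2 then p.2 else p.1.
have max2l p : ole p.1 (max2 p).
  by rewrite /max2; case: ifP => // _; exact: ole_refl.
have max2r p : ole p.2 (max2 p).
  rewrite /max2; case: ifP => [_|h]; first exact: ole_refl.
  by case: (ole_total p.1 p.2) => //; rewrite h.
pose Q0 := Ordnum wR0.
pose R : rel (W * W) := fun p q =>
  `[< olt (max2 p) (max2 q) \/ max2 p = max2 q /\ R0 p q >].
have wR : well_order R.
  apply: antisymmetric_well_order.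
    move=> p q /andP[/asboolP + /asboolP].
    move=> [pq|[pq Rpq]] [qp|[qp Rqp]].
    - by case: (olt_irr (olt_trans pq qp)).
    - by move: pq; rewrite qp => /olt_irr.
    - by move: qp; rewrite pq => /olt_irr.
    - exact: (@ole_anti Q0).
  move=> A [p Ap].
  have [m [[q [Aq qm]] mmin]] := @ole_least W [set m | exists q, q \in A /\ max2 q = m]
    (ex_intro _ _ (ex_intro _ p (conj Ap erefl))).
  have [r [[Ar rm] rmin]] := @ole_least Q0 [set r : W * W | r \in A /\ max2 r = m]
    (ex_intro _ q (conj Aq qm)).
  exists r; split=> // s As; apply/asboolP.
  have := mmin (max2 s) (ex_intro _ s (conj As erefl)) => ms.
  have [e|ne] := pselect (max2 s = m).
    by right; split; [rewrite rm e|apply: rmin].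
  by left; rewrite rm; split=> // /esym.
pose Q1 := Ordnum wR.
have := @card_le_greedy Q1 (set_type D).
rewrite (card_le_eqr (card_setT D)).
apply: card_le_trans; apply: subset_card_le => p [Dp1 Dp2] /=.
rewrite (card_le_eql (card_setT D)) => Dp.
apply: (hD (max2 p)); first by rewrite /max2; case: ifP.
apply: card_le_trans Dp _; apply: subset_card_le => q [/asboolP qp _].
have {qp} : ole (max2 q) (max2 p).
  by case: qp => [[]//|[-> _]]; exact: ole_refl.
by move=> qp; split=> /=; apply: ole_trans qp; [exact: max2l|exact: max2r].
Qed.

(** The induction step of Hessenberg's theorem. If [D] is no larger than one of
    its initial segments, the induction hypothesis transfers; otherwise every
    initial segment of [D] is smaller than [D], and so is its square, by
    induction or because it is finite. *)
Lemma card_le_sq_ind (W : ordnum) (D : set W) :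
  (forall a b, D a -> olt b a -> D b) ->
  (forall m, D m -> infinite_set [set b | olt b m] ->
    [set b | olt b m] `*` [set b | olt b m] #<= [set b | olt b m]) ->
  infinite_set D -> D `*` D #<= D.
Proof.
move=> Ddown IH iD.
have [[m [Dm Dlem]]|nD] := pselect (exists m, D m /\ D #<= [set b | olt b m]).
  have im : infinite_set [set b | olt b m].
    by move=> /(card_le_finite Dlem).
  apply: card_le_trans (card_le_setX Dlem Dlem) _.
  apply: card_le_trans (IH _ Dm im) _.
  by apply: subset_card_le => b /(Ddown _ _ Dm).
apply: card_le_sq_step => m Dm Dle.
have mU : [set b | ole b m] `<=` [set b | olt b m] `|` [set m].
  by move=> b bm; have [->|nb] := pselect (b = m); [right|left].
have im : infinite_set [set b | olt b m].
  move=> fm; apply: iD; apply: card_le_finite Dle _.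
  have : finite_set [set b | ole b m].
    apply: sub_finite_set mU _; rewrite finite_setU; split=> //.
  by move=> h; exact: finite_setX.
have mle : [set b | ole b m] #<= [set b | olt b m].
  by apply: card_le_trans (card_le_setU1 m im); exact: subset_card_le.
apply: nD; exists m; split=> //.
apply: card_le_trans Dle _; apply: card_le_trans (IH _ Dm im).
exact: card_le_setX.
Qed.

(** Hessenberg's theorem, which makes successor cardinals regular. *)
Lemma card_le_sq (k : cardinal) :
  infinite_cardinal k -> [set: k * k] #<= [set: k].
Proof.
have [W <-] := ordnum_on k; move=> iW; rewrite -setXTT.
apply: (@card_le_sq_ind W) => // m _.
elim/(well_founded_induction (@olt_wf W)) : m => m IHm.
apply: card_le_sq_ind => [a b am ba|b bm]; first exact: olt_trans am.
exact: IHm.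
Qed.
Lemma cantor (T : Type) : ~ ([set: set T] #<= [set: T]).
Proof.
move=> le; have [t _] : exists t : T, True.
  apply: contrapT => nt; move: le; rewrite (_ : [set: T] = set0).
    by move=> /card_le0P e; have : [set: set T] set0 by []; rewrite e.
  by rewrite predeqE => x; split=> // _; apply: nt; exists x.
have [f [_ finj]] := card_le_fun t le.
pose D := [set x | exists A : set T, f A = x /\ ~ A x].
have [[A [e nA]]|nD] := pselect (D (f D)).
  by apply: (nA); have -> := finj A D I I e; exists A; split.
by apply: (nD); exists D; split.
Qed.

Lemma initial_segment (W : ordnum) (a : W) : exists V : ordnum,
  [set b | olt b a] #<= [set: V] /\
  forall v : V, exists2 b, olt b a & [set u | olt u v] #<= [set c | olt c b].
Proof.
pose R : rel {b : W | olt b a} := fun u v => ole (sval u) (sval v).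
have sval_inj (u v : {b : W | olt b a}) : sval u = sval v -> u = v.
  by case: u v => [u hu] [v hv] /= e; subst v; congr exist; exact: Prop_irrelevance.
have wR : well_order R.
  apply: antisymmetric_well_order => [u v /andP[uv vu]|A [u Au]].
    by apply: sval_inj; exact: ole_anti uv vu.
  have [m [[v [Av <-]] mmin]] := @ole_least W [set m | exists v, v \in A /\ sval v = m]
    (ex_intro _ _ (ex_intro _ u (conj Au erefl))).
  by exists v; split=> // w Aw; apply: mmin; exists w.
exists (Ordnum wR); split=> [|/= v].
  apply: (@card_le_surj _ _ _ _ sval) => b ba.
  by exists (exist _ b ba).
exists (sval v); first exact: (svalP (v : {b : W | olt b a})).
apply: (@card_le_inj _ _ _ _ sval) => [u [uv nuv]|u w _ _ /sval_inj //].
by split=> // /sval_inj.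
Qed.

(** Well-order the power set of [k], which is larger than [k], and cut at the
    first stage with more than [k] predecessors, if there is one. *)
Lemma succ_card_exists (k : cardinal) : exists theta, is_succ_card k theta.
Proof.
have [W WE] := ordnum_on (set k).
have nW : ~ ([set: W] #<= [set: k]) by rewrite WE; exact: cantor.
have [[a na]|h] := pselect (exists a : W, ~ ([set b | olt b a] #<= [set: k])); last first.
  exists W; split=> // a; apply: contrapT => na; apply: h; by exists a.
have [|m [nm mmin]] := @ole_least W [set a | ~ ([set b | olt b a] #<= [set: k])].
  by exists a.
have [V [Vge Vseg]] := initial_segment m.
exists V; split=> [le|v]; first by apply: nm; exact: card_le_trans le.
have [b bm le] := Vseg v; apply: card_le_trans le _.
by apply: contrapT => /mmin; apply/oltNge.
Qed.

Section SuccessorCardinal.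
Variables (k : cardinal) (theta : ordnum).
Hypothesis k_inf : infinite_cardinal k.
Hypothesis thetaS : is_succ_card k theta.

(** Regularity of the successor of an infinite cardinal: an unbounded family
    would cover [theta] by at most [k] initial segments of size at most [k]. *)
Lemma succ_card_bounded (T : Type) (H : set T) (c : T -> theta) :
  H #<= [set: k] -> exists u, forall h, H h -> ole (c h) u.
Proof.
move=> Hk; apply: contrapT => nu; case: thetaS => nle seg; apply: nle.
have above b : exists h, H h /\ olt b (c h).
  apply: contrapT => nb; apply: nu; exists b => h Hh; apply: contrapT => /oltNge bh.
  by apply: nb; exists h.
have [h hP] := choice above.
have [x _] : exists x : k, True.
  by have [x] := infinite_setN0 k_inf; exists x.
have [i [_ iinj]] := card_le_fun x Hk.
have [e eP] := choice (fun a : theta => card_le_fun x (seg a)).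
apply: card_le_trans (card_le_sq k_inf).
apply: (@card_le_inj _ _ _ _ (fun b => (i (h b), e (c (h b)) b))) => // a b _ _ [].
move=> /(iinj _ _ (hP a).1 (hP b).1) hab; rewrite hab.
by have [_ inj] := eP (c (h b)); apply: inj => /=;
  [rewrite -hab; exact: (hP a).2|exact: (hP b).2].
Qed.

Lemma succ_card_seg (l : Type) : [set: l] #<= [set: k] ->
  exists a : theta, [set: l] #<= [set b | olt b a].
Proof.
move=> lk; apply: contrapT => na; case: thetaS => nle _; apply: nle.
apply: card_le_trans lk; apply: card_le_trans (card_le_greedy theta l).
by apply: subset_card_le => a _ /= h; apply: na; exists a.
Qed.

Lemma succ_card_inhabited : exists a : theta, True.
Proof.
apply: contrapT => na; case: thetaS => nle _; apply: nle.
rewrite /card_leq (_ : [set: theta] = set0); first exact: card_ge0.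
by rewrite predeqE => a; split=> // _; apply: na; exists a.
Qed.

End SuccessorCardinal.

(** The cardinals for which Player I wins have a least element: take the least
    stage of the successor of [k] into whose initial segment one of them
    embeds, and compare it with the others by [card_le_greedy]. *)
Lemma winsI_succ_gd_le (T : topologicalType) (k : cardinal) :
  infinite_cardinal k -> winsI_succ T k -> gd_le T k.
Proof.
move=> ki kw; have [theta thetaS] := succ_card_exists k.
pose M : set theta := [set a | exists l : cardinal,
  [/\ infinite_cardinal l, winsI_succ T l & [set: l] #<= [set b | olt b a]]].
have [a ka] := succ_card_seg thetaS (card_lexx _).
have [|m [[l [li lw lm]] mmin]] := @ole_least theta M; first by exists a, k.
have lmin (l' : cardinal) : infinite_cardinal l' -> winsI_succ T l' -> card_leq l l'.
  move=> li' lw'; apply: card_le_trans lm _.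
  apply: card_le_trans (card_le_greedy theta l'); apply: subset_card_le => b bm /= lb.
  have /mmin : M b by exists l'.
  by apply/oltNge.
by exists l; split; [split|exact: lmin].
Qed.
(** * The forcing calculus *)

Definition before (theta : ordnum) (Z : Type) (x : theta -> Z) (c : theta) : set Z :=
  x @` [set b | olt b c].

Lemma before_mono (theta : ordnum) (Z : Type) (x : theta -> Z) c c' :
  ole c c' -> before x c `<=` before x c'.
Proof. by move=> cc' _ [b bc <-]; exists b => //; exact: olt_ole_trans cc'. Qed.

Lemma before_agree (theta : ordnum) (Z : Type) (x x' : theta -> Z) a c :
  (forall b, olt b a -> x b = x' b) -> ole c a -> before x c = before x' c.
Proof.
move=> xx' ca; rewrite eqEsubset.
by split=> _ [b bc <-]; exists b => //; [apply/esym|]; apply: xx';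
  exact: olt_ole_trans ca.
Qed.

Definition nonempty_open (T : topologicalType) (O : set T) := open O /\ O !=set0.

(** Density in the form in which the game tests it. *)
Definition dense_set (T : topologicalType) (S : set T) := closure S = [set: T].

Section Forcing.
Variables (Z : topologicalType) (theta : ordnum).

(** A strategy here sees a whole play [x : theta -> Z]; that it may use only the
    points played before stage [a] is required by [adapted]. This keeps the
    plays of composed strategies in a single type. *)
Definition forcing_from (t : theta) (Phi : set (set Z))
    (s : theta -> (theta -> Z) -> set Z) : Prop :=
  forall x, (forall a, ole t a -> s a x (x a)) ->
    exists c, ole t c /\ Phi (before x c).

Definition adapted (s : theta -> (theta -> Z) -> set Z) : Prop :=
  (forall a x, nonempty_open (s a x)) /\
  forall a x x', (forall b, olt b a -> x b = x' b) -> s a x = s a x'.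

(** The strategy may have to start at any stage [t]: a strategy started in the
    middle of a play then needs no renumbering of the stages. *)
Definition forces (Phi : set (set Z)) : Prop :=
  forall t, exists2 s, adapted s & forcing_from t Phi s.

Lemma forces_sub (Phi Psi : set (set Z)) :
  Phi `<=` Psi -> forces Phi -> forces Psi.
Proof.
move=> PQ fP t; have [s sa sf] := fP t; exists s => // x xs.
by have [c [tc Pc]] := sf x xs; exists c; split=> //; exact: PQ.
Qed.

Lemma adapted_trivial : adapted (fun _ _ => [set: Z]).
Proof. by split=> // a x; split; [exact: openT|exists (x a)]. Qed.

Lemma forces_true (Phi : set (set Z)) : (forall A, Phi A) -> forces Phi.
Proof.
move=> P t; exists (fun _ _ => setT); first exact: adapted_trivial.
by move=> x _; exists t; split; [exact: ole_refl|].
Qed.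

End Forcing.

Section ForcingComposition.
Variables (k : cardinal) (theta : ordnum).
Hypothesis k_inf : infinite_cardinal k.
Hypothesis thetaS : is_succ_card k theta.

(** A last stage [t] would make [theta] the union of a set of size at most [k]
    and one point. *)
Lemma succ_card_nomax (t : theta) : exists c, olt t c.
Proof.
apply: contrapT => nc; case: thetaS => nle seg; apply: nle.
have tmax b : olt b t \/ b = t.
  have [bt|->|tb] := olt_total b t; [by left|by right|].
  by case: nc; exists b.
have kO : [set: option k] #<= [set: k].
  have iS : infinite_set (range (@Some k)).
    by move=> fS; apply: k_inf; rewrite -(eq_finite_set (@card_some _ [set: k])).
  apply: card_le_trans (card_image_le (@Some k) _).
  apply: card_le_trans (card_le_setU1 None iS); apply: subset_card_le.
  by move=> [y|] _; [left; exists y|right].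
apply: card_le_trans kO.
have [y _] : exists y : k, True.
  by have [y] := infinite_setN0 k_inf; exists y.
have [f [_ finj]] := card_le_fun y (seg t).
pose g b := if pselect (olt b t) is left _ then Some (f b) else None.
apply: (@card_le_inj _ _ _ _ g) => // a b _ _; rewrite /g.
case: pselect => at_; case: pselect => bt //; first by case=> /(finj _ _ at_ bt).
by case: (tmax a) => // ->; case: (tmax b).
Qed.

Lemma forces_hit (Z : topologicalType) (U : set Z) : nonempty_open U ->
  forces theta [set A | (A `&` U) !=set0].
Proof.
move=> Uop t; exists (fun _ _ => U) => // x xU.
have [c tc] := succ_card_nomax t; exists c; split; first by case: tc.
by exists (x t); split; [exists t|apply: xU; exact: ole_refl].
Qed.

(** A game abstracted from its topology: [L] are the sets that Player I may
    play, [D] the sets of points that end it. Besides the games on the factors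
    this covers running through an index set, see [forces_all]. *)
Definition winnable (T : Type) (L D : set (set T)) : Prop :=
  exists (V : ordnum) (s : forall v : V, ({u : V | olt u v} -> set T * T) -> set T),
  [/\ forall v : V, [set u | olt u v] #<= [set: k],
      forall v h, (forall u, L (h u).1 /\ (h u).1 (h u).2) ->
        ~ D (range (fun u => (h u).2)) -> L (s v h)
    & forall p : V -> set T * T,
        (forall v, ~ D (range (fun u : {u | olt u v} => (p (sval u)).2)) ->
          (p v).1 = s v (fun u => p (sval u)) /\ (p v).1 (p v).2) ->
        exists v, D (range (fun u : {u | olt u v} => (p (sval u)).2))].

(** The imagined game of Player I on [T] is played along [V], while the real
    game is played along [theta]. Round [v] of the former occupies the stages
    of the latter from [begin x v] on, until the answer [reply x v] to the
    prescribed set [move x v] has been forced, at stage [fin x v]. All of this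
    is a function of the real play [x]. *)
Section Composition.
Variables (Z : topologicalType) (T : Type) (L D : set (set T)).
Variables (V : ordnum) (s : forall v : V, ({u : V | olt u v} -> set T * T) -> set T).
Hypothesis seg_le : forall v : V, [set u | olt u v] #<= [set: k].
Hypothesis s_legal : forall v h, (forall u, L (h u).1 /\ (h u).1 (h u).2) ->
  ~ D (range (fun u => (h u).2)) -> L (@s v h).
Hypothesis s_wins : forall p : V -> set T * T,
  (forall v, ~ D (range (fun u : {u | olt u v} => (p (sval u)).2)) ->
    (p v).1 = s (fun u : {u | olt u v} => p (sval u)) /\ (p v).1 (p v).2) ->
  exists v, D (range (fun u : {u | olt u v} => (p (sval u)).2)).
Hypothesis D_mono : forall A B, A `<=` B -> D A -> D B.
Variable y0 : T.
Variable R : T -> set Z -> Prop.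
Hypothesis R_mono : forall y A B, A `<=` B -> R y A -> R y B.
Variable S : set T * theta -> theta -> (theta -> Z) -> set Z.
Hypothesis S_adapted : forall p, adapted (S p).
Hypothesis S_forces : forall p, L p.1 ->
  forcing_from p.2 [set A | exists y, p.1 y /\ R y A] (S p).
Variable t : theta.
Implicit Types (x : theta -> Z) (v u : V) (a c : theta) (O : set T).

Let least (P : set theta) : theta :=
  xget (t : {classic theta}) [set c | P c /\ forall c', P c' -> ole c c'].

Let leastP (P : set theta) : P !=set0 ->
  P (least P) /\ forall c, P c -> ole (least P) c.
Proof.
move=> /ole_least[m mP].
by have /xgetPex : exists c : {classic theta}, P c /\ forall c', P c' -> ole c c';
  [exists m|apply].
Qed.

Let done x O tau c := ole tau c /\ exists y, O y /\ R y (before x c).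

(* The defaults [t] and [y0] are returned only for rounds that are never
   completed, and for the rounds after them. *)
Let outcome x v (rec : {u | olt u v} -> (set T * T) * theta) : (set T * T) * theta :=
  let O := s (fun w => (rec w).1) in
  let tau := least [set a | ole t a /\ forall w, ole (rec w).2 a] in
  let c := least (done x O tau) in
  (O, xget (y0 : {classic T}) [set y | O y /\ R y (before x c)], c).

Let run x : V -> (set T * T) * theta :=
  Fix (@olt_wf V) (fun=> ((set T * T) * theta)%type)
    (fun v rec => outcome x (fun u : {u | olt u v} => rec (sval u) (svalP u))).

Let runE x v : run x v = outcome x (fun u : {u | olt u v} => run x (sval u)).
Proof.
rewrite {1}/run Fix_eq // => w f g fg; congr outcome.
by apply/funext => u; exact: fg.
Qed.

Let move x v := (run x v).1.1.
Let reply x v := (run x v).1.2.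
Let fin x v := (run x v).2.
Let begin x v := least [set a | ole t a /\ forall u, olt u v -> ole (fin x u) a].
Let complete x v := exists c, done x (move x v) (begin x v) c.

Let moveE x v : move x v = s (fun u : {u | olt u v} => (run x (sval u)).1).
Proof. by rewrite /move runE. Qed.

Let finE x v : fin x v = least (done x (move x v) (begin x v)).
Proof.
rewrite moveE /fin runE /outcome /=; congr (least (done _ _ (least _))).
rewrite predeqE => a; split=> -[ta h]; split=> //.
  by move=> u uv; exact: (h (exist _ u uv)).
by move=> u; exact: h (svalP u).
Qed.

Let replyE x v : reply x v =
  xget (y0 : {classic T}) [set y | move x v y /\ R y (before x (fin x v))].
Proof. by rewrite /reply /move /fin runE. Qed.

Let completeP x v : complete x v ->
  [/\ ole (begin x v) (fin x v), move x v (reply x v),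
      R (reply x v) (before x (fin x v)) &
      forall c, done x (move x v) (begin x v) c -> ole (fin x v) c].
Proof.
move=> /leastP; rewrite -finE => -[[bf ey] fmin].
by have := @xgetPex {classic T} y0 _ ey; rewrite -replyE => -[].
Qed.

Let beginP x v : ole t (begin x v) /\ forall u, olt u v -> ole (fin x u) (begin x v).
Proof.
have [|h _] := @leastP [set a | ole t a /\ forall u, olt u v -> ole (fin x u) a].
  have [m mP] := succ_card_bounded k_inf thetaS (fin x) (seg_le v).
  have [tm|mt] := ole_total t m; first by exists m.
  by exists t; split=> [|u /mP um]; [exact: ole_refl|exact: ole_trans mt].
exact: h.
Qed.

Let agree_step x x' v : (forall u, olt u v -> run x u = run x' u) ->
  move x v = move x' v /\ begin x v = begin x' v.
Proof.
move=> rr; split.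
  by rewrite !moveE; congr (s _); apply/funext => u; rewrite rr //; exact: (svalP u).
rewrite /begin; congr least; rewrite predeqE => a.
by split=> -[ta h]; split=> // u uv; have := h u uv; rewrite /fin rr.
Qed.

Let ready x v a := forall u, olt u v -> complete x u /\ ole (fin x u) a.

Let active x v a := [/\ ready x v a, ole (begin x v) a, L (move x v) &
  ~ exists2 c, ole c a & done x (move x v) (begin x v) c].

Let done_agree x x' O tau a c : (forall b, olt b a -> x b = x' b) -> ole c a ->
  done x O tau c = done x' O tau c.
Proof. by move=> xx' ca; rewrite /done (before_agree xx' ca). Qed.

Let agree_complete x x' a v : (forall b, olt b a -> x b = x' b) ->
  move x v = move x' v -> begin x v = begin x' v ->
  complete x v -> ole (fin x v) a -> complete x' v /\ run x v = run x' v.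
Proof.
move=> xx' em eb cx fa; have [bf xm xR fmin] := completeP cx.
have dx : done x (move x v) (begin x v) (fin x v) by split=> //; exists (reply x v).
have cx' : complete x' v.
  by exists (fin x v); rewrite -em -eb -(done_agree _ _ xx' fa).
split=> //; have [bf' xm' xR' fmin'] := completeP cx'.
have f'f : ole (fin x' v) (fin x v).
  by apply: fmin'; rewrite -em -eb -(done_agree _ _ xx' fa).
have ef : fin x v = fin x' v.
  apply: ole_anti => //; apply: fmin; have fa' := ole_trans f'f fa.
  by rewrite (done_agree _ _ xx' fa') em eb; split=> //; exists (reply x' v).
have ey : reply x v = reply x' v.
  by rewrite !replyE em ef (@before_agree _ _ x x' a) // -ef.
by rewrite [LHS]surjective_pairing [(run x v).1]surjective_pairing
  [RHS]surjective_pairing [(run x' v).1]surjective_pairing;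
  congr (_, _, _).
Qed.

(* The rounds that are over by stage [a] depend only on the points played
   before [a]; this is what makes the composed strategy adapted. *)
Let agree x x' a v : (forall b, olt b a -> x b = x' b) -> ready x v a ->
  forall u, olt u v -> complete x' u /\ run x u = run x' u.
Proof.
move=> xx' rv; elim/(well_founded_induction (@olt_wf V)) => u IHu uv.
have [cu fu] := rv u uv.
have [|em eb] := @agree_step x x' u.
  by move=> w wu; have [] := IHu w wu (olt_trans wu uv).
exact: agree_complete cu fu.
Qed.

Let active_agree x x' a v : (forall b, olt b a -> x b = x' b) -> active x v a ->
  [/\ active x' v a, move x v = move x' v & begin x v = begin x' v].
Proof.
move=> xx' [rv bv Lv nd]; have ag := agree xx' rv.
have [|em eb] := @agree_step x x' v; first by move=> u /ag[].
split=> //; split; rewrite -?em -?eb //.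
  by move=> u uv; have [cu ru] := ag u uv; split=> //; rewrite /fin -ru; apply (rv u uv).2.
by move=> [c ca]; rewrite -(done_agree _ _ xx' ca) => dc; apply: nd; exists c.
Qed.

Let active_inj x v v' a : active x v a -> active x v' a -> v = v'.
Proof.
suff H w w' : active x w a -> active x w' a -> ~ olt w w'.
  by move=> av av'; have [/(H _ _ av av')|//|/(H _ _ av' av)] := olt_total v v'.
move=> [_ _ _ nd] [rw' _ _ _] ww'; apply: nd.
have [cw fw] := rw' w ww'; exists (fin x w) => //.
by have [bf xm xR _] := completeP cw; split=> //; exists (reply x w).
Qed.

Let stage_of x a : set T * theta :=
  xget ((setT, t) : {classic set T * theta})
    [set p | exists2 v, active x v a & p = (move x v, begin x v)].

Let master a x := S (stage_of x a) a x.

Let master_adapted : adapted master.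
Proof.
split=> [a x|a x x' xx']; first by case: (S_adapted (stage_of x a)) => + _; exact.
rewrite /master (_ : stage_of x a = stage_of x' a).
  by have [_] := S_adapted (stage_of x' a); exact.
suff e : [set p | exists2 v, active x v a & p = (move x v, begin x v)] =
    [set p | exists2 v, active x' v a & p = (move x' v, begin x' v)].
  by rewrite /stage_of e.
rewrite predeqE => p; split=> -[v av ->].
  by have [av' -> ->] := active_agree xx' av; exists v.
have x'x b : olt b a -> x' b = x b by move=> /xx'.
by have [av' -> ->] := active_agree x'x av; exists v.
Qed.

Let masterE x v a : active x v a -> master a x = S (move x v, begin x v) a x.
Proof.
move=> av; rewrite /master; congr (S _ _ _).
have : exists p, exists2 v, active x v a & p = (move x v, begin x v).
  by exists (move x v, begin x v), v.
move=> /(@xgetPex {classic set T * theta} (setT, t)).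
by rewrite -/(stage_of x a) => -[w aw ->]; rewrite (active_inj aw av).
Qed.

Let points x v := range (fun u : {u | olt u v} => reply x (sval u)).

Let points_mono x u v : olt u v -> points x u `<=` points x v.
Proof.
move=> uv _ [[w wu] _ <-] /=.
by exists (exist _ w (olt_trans wu uv)).
Qed.

Let progress x : (forall a, ole t a -> master a x (x a)) ->
  forall v, ~ D (points x v) -> L (move x v) /\ complete x v.
Proof.
move=> xm; elim/(well_founded_induction (@olt_wf V)) => v IHv nD.
have below u : olt u v -> L (move x u) /\ complete x u.
  by move=> uv; apply: IHv => // Du; apply: nD; exact: D_mono (points_mono uv) Du.
have Lv : L (move x v).
  rewrite moveE; apply: s_legal => // u; have [Lu cu] := below _ (svalP u).
  by have [_ mu _ _] := completeP cu.
split=> //; apply: contrapT => nc.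
have [tb fb] := beginP x v.
have av a : ole (begin x v) a -> active x v a.
  move=> ba; split=> //; last by move=> [c _ dc]; apply: nc; exists c.
  move=> u uv; split; first by have [] := below u uv.
  by apply: ole_trans ba; exact: fb.
have [a ba|c [bc [y yP]]] := @S_forces (move x v, begin x v) Lv x.
  by rewrite -(masterE (av _ ba)); apply: xm; exact: ole_trans ba.
by apply: nc; exists c; split=> //; exists y.
Qed.

(** Every round is completed as long as the imagined game is not over, because
    its strategy is followed from [begin x v] on; so the imagined game is a play
    of the winning strategy, and it ends. *)
Lemma forcing_from_composition : exists2 m, adapted m &
  forcing_from t [set A | D [set y | R y A]] m.
Proof.
exists master; first exact: master_adapted.
move=> x xm; have prog := progress xm.
have [v0 Dv0] : exists v, D (points x v).
  apply: (@s_wins (fun v => (run x v).1)) => v nD; have [_ cv] := prog v nD.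
  by have [_ mv _ _] := completeP cv; split=> //; rewrite -moveE.
have [v [Dv vmin]] := @ole_least V [set v | D (points x v)] (ex_intro _ _ Dv0).
have [tb fb] := beginP x v.
exists (begin x v); split=> //; apply: D_mono Dv => _ [[u uv] _ <-] /=.
have [|_ cu] := prog u; first by move=> /vmin; apply/oltNge.
have [_ _ Ru _] := completeP cu; apply: R_mono Ru.
by apply: before_mono; exact: fb.
Qed.

End Composition.

(** Play a winning strategy on [T] in the imagination, forcing its answers one
    after the other; regularity of [theta] leaves enough stages for that. *)
Lemma forces_winnable (Z : topologicalType) (T : Type) (L D : set (set T)) (y0 : T)
    (R : T -> set Z -> Prop) :
  winnable L D ->
  (forall A B, A `<=` B -> D A -> D B) ->
  (forall y A B, A `<=` B -> R y A -> R y B) ->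
  (forall O, L O -> forces theta [set A | exists y, O y /\ R y A]) ->
  forces theta [set A | D [set y | R y A]].
Proof.
move=> [V [s [seg_le s_legal s_wins]]] D_mono R_mono hO t.
have /choice[S SP] : forall p : set T * theta, exists s : theta -> (theta -> Z) -> set Z,
    adapted s /\ (L p.1 -> forcing_from p.2 [set A | exists y, p.1 y /\ R y A] s).
  move=> [O tau]; have [LO|nLO] := pselect (L O).
    by have [s0 sa sf] := hO O LO tau; exists s0.
  by exists (fun _ _ => setT); split=> [|/nLO//]; exact: adapted_trivial.
exact: (@forcing_from_composition Z T L D V s seg_le s_legal s_wins D_mono y0 R
  R_mono S (fun p => (SP p).1) (fun p => (SP p).2) t).
Qed.

(** A conjunction of at most [k] properties, forced one after the other: this is
    [forces_winnable] for the game in which Player I names the indices. *)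
Lemma forces_all (Z : topologicalType) (J : Type) (Phi : J -> set (set Z)) :
  [set: J] #<= [set: k] ->
  (forall j A B, A `<=` B -> Phi j A -> Phi j B) ->
  (forall j, forces theta (Phi j)) -> forces theta [set A | forall j, Phi j A].
Proof.
move=> Jk Pmono hP.
have [[j0 _]|nJ] := pselect (exists j : J, True); last first.
  by apply: forces_true => A j; case: nJ; exists j.
have [e Je] := succ_card_seg thetaS Jk.
have [i [iP iinj]] : exists i : J -> theta, (forall j, olt (i j) e) /\ injective i.
  have [i [iP iinj]] := card_le_fun e Je.
  by exists i; split=> [j|j j' /(iinj _ _ I I)]; first exact: iP.
pose dec a := xget (j0 : {classic J}) [set j | i j = a].
have decK j : dec (i j) = j.
  apply: iinj.
  exact: (@xgetPex {classic J} j0 [set j' | i j' = i j] (ex_intro _ j erefl)).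
have Jw : winnable [set O | exists j : J, O = [set j]] [set A | A = [set: J]].
  exists theta, (fun a _ => [set dec a]); split=> [a|a h _ _|p pP].
  - by case: thetaS.
  - by exists (dec a).
  apply: contrapT => np; apply: (np); exists e; rewrite /= predeqE => j; split=> // _.
  exists (exist _ (i j) (iP j)) => //=.
  have [|-> ->] := pP (i j); last by rewrite decK.
  by move=> full; apply: np; exists (i j).
apply: forces_sub (forces_winnable j0 Jw _ Pmono _) => [A full j|A B AB|O [j ->]].
- by have : [set j | Phi j A] j by rewrite full.
- by move=> /= full; rewrite predeqE => j; split=> // _; apply: AB; rewrite full.
- by apply: forces_sub (hP j) => A PA; exists j.
Qed.
End ForcingComposition.
(** * Between strategies in the game and forcing *)

Lemma dense_set_mono (T : topologicalType) (A B : set T) :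
  A `<=` B -> dense_set A -> dense_set B.
Proof.
move=> AB dA; rewrite /dense_set -subTset -dA; exact: closure_subset.
Qed.

Lemma gd_le_winnable (T : topologicalType) (k : cardinal) : gd_le T k ->
  winnable k (@nonempty_open T) (@dense_set T).
Proof.
move=> [l [[_ [V [[_ seg] [s [s_legal s_wins]]]] _] lk]].
exists V, s; split=> [v|v h hL nD|p pP].
- exact: card_le_trans (seg v) lk.
- by apply: s_legal => // u; have [[hu hu'] hx] := hL u; split.
have [v [Dv _]] := s_wins p pP.
by exists v.
Qed.

Lemma forces_winsI (Z : topologicalType) (k : cardinal) (theta : ordnum) :
  infinite_cardinal k -> is_succ_card k theta -> forces theta (@dense_set Z) ->
  winsI_succ Z k.
Proof.
move=> ki thetaS fD; exists theta; split=> //.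
have [t0 _] := succ_card_inhabited thetaS.
have [t [_ tmin]] := @ole_least theta setT (ex_intro _ t0 I).
have [s [s_open s_local] s_wins] := fD t.
have [[z0 _]|nZ] := pselect (exists z : Z, True); last first.
  exists (fun _ _ => setT); split=> [a h _ []|p _].
    by rewrite /over predeqE => z; case: nZ; exists z.
  by case: nZ; exists (p t).2.
pose ext (a : theta) (h : history Z a) b :=
  if pselect (olt b a) is left ba then (h (exist _ b ba)).2 else z0.
exists (fun a h => s a (@ext a h)); split=> [a h _ _|p pP]; first exact: s_open.
apply: contrapT => nwin.
have never a : ~ over (past p a).
  move=> oa; apply: nwin.
  have [m [om mmin]] := @ole_least theta [set a | over (past p a)] (ex_intro _ a oa).
  by exists m; split=> // b bm /mmin; apply/oltNge.
have [a _|c [_ Dc]] := s_wins (fun b => (p b).2).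
  have [e pa] := pP a (never a).
  have <- : s a (ext a (past p a)) = s a (fun b => (p b).2).
    by apply: s_local => b ba; rewrite /ext; case: pselect.
  by rewrite -e.
apply: (never c); rewrite /over -[RHS]Dc; congr closure.
rewrite eqEsubset; split=> z; first by move=> [[b bc] _ <-]; exists b.
by move=> [b bc <-]; exists (exist _ b bc).
Qed.
(** * Boxes in products *)

Lemma closure_openP (T : topologicalType) (A : set T) (v : T) :
  closure A v <-> forall N, open N -> N v -> exists2 a, A a & N a.
Proof.
split=> [cAv N oN Nv|h B].
  have [a [Aa Na]] := cAv N (open_nbhs_nbhs (conj oN Nv)).
  by exists a.
rewrite nbhsE => -[N [oN Nv] NB].
by have [a Aa Na] := h N oN Nv; exists a; split=> //; exact: NB.
Qed.

Lemma not_closureP (T : topologicalType) (A : set T) (v : T) :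
  ~ closure A v <-> exists N, [/\ open N, N v & forall a, A a -> ~ N a].
Proof.
rewrite closure_openP; split=> [h|[N [oN Nv NA]] h]; last first.
  by have [a /NA] := h N oN Nv.
apply: contrapT => nN; apply: h => N oN Nv; apply: contrapT => nA; apply: nN.
by exists N; split=> // a Aa Na; apply: nA; exists a.
Qed.

Lemma dense_setP (T : topologicalType) (A : set T) :
  dense_set A <-> forall N, nonempty_open N -> exists2 a, A a & N a.
Proof.
split=> [dA N [oN [v Nv]]|h].
  by have : closure A v; [rewrite dA|move=> /closure_openP; apply].
by rewrite /dense_set -subTset => v _; apply/closure_openP => N oN Nv; apply: h; split=> //;
  exists v.
Qed.

Section Products.
Variables (I : Type) (X : I -> topologicalType).

Lemma open_cylinder (i : I) (O : set (X i)) :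
  open O -> open [set z : product X | O (z i)].
Proof.
move=> oO.
have h := (continuousP (@proj {classic I} X i : product X -> X i)).1
  (@proj_continuous {classic I} X i).
exact: h.
Qed.

(** Proved through filters: the sets that contain a finitely restricted box
    around [z] form a filter, which converges to [z] coordinate by
    coordinate. *)
Lemma box_nbhs (N : set (product X)) (z : product X) : open N -> N z ->
  exists (G : set I) (O : forall i, set (X i)),
    [/\ finite_set G, forall i, open (O i) /\ O i (z i)
      & forall w : product X, (forall i, G i -> O i (w i)) -> N w].
Proof.
pose F : set_system (forall i, X i) := [set M | exists (G : set I) (O : forall i, set (X i)),
    [/\ finite_set G, forall i, open (O i) /\ O i (z i)
      & forall w : product X, (forall i, G i -> O i (w i)) -> M w]].
have FF : Filter F.
  split=> [|M M'|M M' MM'].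
  - exists set0, (fun=> setT); split=> // i; split=> //; exact: openT.
  - move=> [G [O [Gf zO OM]]] [G' [O' [Gf' zO' OM']]].
    exists (G `|` G'), (fun i => O i `&` O' i); split=> [|i|w wO].
    + by rewrite finite_setU.
    + have [oO Oz] := zO i; have [oO' Oz'] := zO' i.
      by split; [exact: openI|split].
    + by split; [apply: OM => i Gi; have [] := wO i (or_introl Gi)|
        apply: OM' => i Gi; have [] := wO i (or_intror Gi)].
  - move=> [G [O [Gf zO OM]]]; exists G, O; split=> // w wO; exact/MM'/OM.
have Fz : F --> (z : product X).
  apply/cvg_sup => i M.
  rewrite (@nbhsE (initial_topology (fun f : forall i, X i => f i))).
  move=> -[_ [[O oO <-] Oz] OM].
  pose O' j : set (X j) := [set y | forall e : j = i, O (ecast j (X j) e y)].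
  exists [set i], O'; split=> [|j|w wO].
  - exact: finite_set1.
  - have [e|ne] := pselect (j = i).
      subst j; have -> : O' i = O; last by [].
      rewrite predeqE => y; split=> [/(_ erefl)//|Oy e].
      by rewrite (Prop_irrelevance e erefl).
    have -> : O' j = setT; last by split=> //; exact: openT.
    by rewrite predeqE => y; split=> // _ e.
  - by apply: OM; have := wO i erefl erefl.
by move=> oN Nz; apply: Fz; exact: open_nbhs_nbhs.
Qed.

End Products.
Lemma open_all_in (T : topologicalType) (E : eqType) (s : seq E) (F : E -> set T) :
  (forall e, open (F e)) -> open [set u | forall e, e \in s -> F e u].
Proof.
move=> oF; elim: s => [|e s IHs].
  by rewrite (_ : [set _ | _] = setT); [exact: openT|rewrite predeqE].
have -> : [set u | forall e', e' \in e :: s -> F e' u] =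
    F e `&` [set u | forall e', e' \in s -> F e' u].
  rewrite predeqE => u; split=> [h|[Fe h] e'].
    by split=> [|e' e's]; apply: h; rewrite inE ?eqxx ?e's ?orbT.
  by rewrite inE => /orP[/eqP ->|/h].
exact: openI.
Qed.

Lemma dense_all_in (T : topologicalType) (E : eqType) (s : seq E) (F : E -> set T) :
  (forall e, open (F e)) -> (forall e, dense_set (F e)) ->
  dense_set [set u | forall e, e \in s -> F e u].
Proof.
move=> oF dF; elim: s => [|e s /dense_setP IHs].
  by apply/dense_setP => N [_ [u Nu]]; exists u.
apply/dense_setP => N [oN [u Nu]].
have /dense_setP/(_ N)[|v Fv Nv] := dF e; first by split=> //; exists u.
have [|w wF [Nw Fw]] := IHs (N `&` F e).
  by split; [apply: openI => //|exists v].
by exists w => // e'; rewrite inE => /orP[/eqP ->|/wF].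
Qed.

(** * Forcing in a finite product *)

(** The points are played in a space [Z] that maps continuously onto the finite
    product; in the application [Z] is the full product. *)
Section FiniteProduct.
Variables (k : cardinal) (theta : ordnum).
Hypothesis k_inf : infinite_cardinal k.
Hypothesis thetaS : is_succ_card k theta.
Variables (J : eqType) (es : seq J) (Y : J -> topologicalType).
Hypothesis esP : forall j, j \in es.
Hypothesis Y_win : forall j, winnable k (@nonempty_open (Y j)) (@dense_set (Y j)).
Variable u0 : product Y.
Implicit Types (i j : J) (u v w : product Y) (U N : set (product Y)).

Definition box (B : forall j, set (Y j)) : set (product Y) := [set u | forall j, B j (u j)].

Lemma open_box B : (forall j, open (B j)) -> open (box B).
Proof.
move=> oB.
have -> : box B = [set u | forall j, j \in es -> B j (u j)].
  by rewrite predeqE => u; split=> [h j _|h j]; [exact: h|exact: (h j (esP j))].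
by apply: open_all_in => j; exact: open_cylinder.
Qed.

Lemma box_sub N u : open N -> N u ->
  exists B, [/\ forall j, open (B j), box B u & box B `<=` N].
Proof.
move=> oN Nu; have [G [B [_ Bu BN]]] := box_nbhs oN Nu.
by exists B; split=> [j|j|w Bw]; [exact: (Bu j).1|exact: (Bu j).2|exact: BN].
Qed.

Lemma open_proj j U : open U -> open [set y | exists2 u, U u & u j = y].
Proof. exact: proj_open. Qed.

Variables (Z : topologicalType) (f : Z -> product Y).
Hypothesis f_cont : forall U, open U -> open (f @^-1` U).
Hypothesis f_surj : forall u, exists z, f z = u.

Definition forced (Phi : set (set (product Y))) : Prop :=
  forces theta [set A | Phi (f @` A)].

Lemma forced_sub (Phi Psi : set (set (product Y))) :
  Phi `<=` Psi -> forced Phi -> forced Psi.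
Proof. by move=> PP; apply: forces_sub => A; exact: PP. Qed.

Lemma forced_hit U : nonempty_open U -> forced [set A | exists2 a, A a & U a].
Proof.
move=> [oU [u Uu]]; have [z fz] := f_surj u.
apply: forces_sub (@forces_hit _ _ k_inf thetaS _ (f @^-1` U) _) => [A [a [Aa Ua]]|].
  by exists (f a) => //; exists a.
by split; [exact: f_cont|exists z; rewrite /= fz].
Qed.

Lemma forced_coordinate j (R : Y j -> set (product Y) -> Prop) :
  (forall y A A', A `<=` A' -> R y A -> R y A') ->
  (forall O, nonempty_open O -> forced [set A | exists2 y, O y & R y A]) ->
  forced [set A | dense_set [set y | R y A]].
Proof.
move=> R_mono hO.
apply: forces_sub (@forces_winnable _ _ k_inf thetaS Z _ _ _ (u0 j)
  (fun y A => R y (f @` A)) (Y_win j) _ _ _) => [A //|A B|y A B AB|O /hO].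
- exact: dense_set_mono.
- by apply: R_mono; exact: image_subset.
- by apply: forces_sub => A [y Oy Ry]; exists y.
Qed.

Lemma J_le_k : [set: J] #<= [set: k].
Proof.
apply: card_le_trans ((infiniteP _).1 k_inf).
apply: (@card_le_inj _ _ _ _ (fun j => index j es)) => // i j _ _ e.
by rewrite -(nth_index i (esP i)) e nth_index.
Qed.

(** Coordinatewise density of [A] in each [V b]; this is the hypothesis on [A]
    in the tightness condition. *)
Definition coord_dense (V : k -> set (product Y)) A : Prop :=
  forall b j u, V b u -> forall O, open O -> O (u j) ->
    exists a, [/\ A a, V b a & O (a j)].

(** For fixed [b] and [j], run the game on [Y j] for the property of [y] that it
    is the [j]-th coordinate of a played point of [V b], or is not in the
    projection of [V b] at all. *)
Lemma forced_coord_dense V : (forall b, open (V b)) -> forced (coord_dense V).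
Proof.
move=> oV.
pose Phi (b : k) j A := forall u, V b u -> forall O, open O -> O (u j) ->
  exists a, [/\ A a, V b a & O (a j)].
have Phi_mono b j A A' : A `<=` A' -> Phi b j A -> Phi b j A'.
  move=> AA' h u Vu O oO Ou; have [a [Aa Va Oa]] := h u Vu O oO Ou.
  by exists a; split=> //; exact: AA'.
have hPhi b j : forced (Phi b j).
  pose R y A := (exists a, [/\ A a, V b a & a j = y]) \/ ~ exists2 u, V b u & u j = y.
  apply: forced_sub (@forced_coordinate j R _ _) => [A dR u Vu O oO Ou|y A A' AA'|O].
  - move: dR => /dense_setP/(_ (O `&` [set y | exists2 u, V b u & u j = y]))[|y].
      split; first by apply: openI => //; exact: open_proj.
      by exists (u j); split=> //; exists u.
    by move=> [[a [Aa Va aj]]|nVy] [Oy Vy] //; exists a; rewrite aj.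
  - move=> [[a [Aa Va aj]]|nVy]; last by right.
    by left; exists a; split=> //; exact: AA'.
  - move=> [oO [y Oy]].
    have [[u [Vu Ou]]|nV] := pselect (exists u, V b u /\ O (u j)); last first.
      apply: forces_true => A; exists y => //; right=> -[u Vu uy].
      by apply: nV; exists u; rewrite uy.
    apply: forced_sub (@forced_hit (V b `&` [set u | O (u j)]) _) => [A [a Aa [Va Oa]]|].
      by exists (a j) => //; left; exists a.
    by split; [apply: openI => //; exact: open_cylinder|exists u].
apply: forces_sub (@forces_all _ _ k_inf thetaS Z k
  (fun b => [set A | forall j, Phi b j (f @` A)]) (card_lexx _) _ _).
- by move=> A h b j u; exact: h.
- by move=> b A A' AA' h j; apply: Phi_mono (h j); exact: image_subset.
- move=> b; apply: (@forces_all _ _ k_inf thetaS Z J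
    (fun j => [set A | Phi b j (f @` A)]) J_le_k) => [j A A' AA'|j].
    by apply: Phi_mono; exact: image_subset.
  exact: hPhi.
Qed.

(** Equivalent to the conclusion of the tightness condition: the projection of
    [U `\` closure A] to coordinate [j] misses a point of that of [U]. *)
Definition covers_slice j U A : Prop :=
  exists2 u, U u & forall v, U v -> v j = u j -> closure A v.

Definition fillable U : Prop := forced [set A | U `<=` closure A].

(** No choice of [V] lets coordinatewise density in [V] cover a slice in
    coordinate [j]. Unlike a statement about the strategies of Player I, this
    provides sets [A] that can be glued together. *)
Definition evasive j U : Prop :=
  forall V, (forall b, open (V b)) ->
  exists A, coord_dense V A /\
    forall u, U u -> exists v, [/\ U v, v j = u j & ~ closure A v].

Lemma forced_covers_slice j U : ~ evasive j U -> forced (covers_slice j U).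
Proof.
move=> nev.
have [V [oV hV]] : exists V, (forall b, open (V b)) /\
    forall A, coord_dense V A -> covers_slice j U A.
  apply: contrapT => nV; apply: nev => V oV; apply: contrapT => nA.
  apply: nV; exists V; split=> // A cA; apply: contrapT => ncov.
  apply: nA; exists A; split=> // u Uu; apply: contrapT => nv.
  apply: ncov; exists u => // v Uv vu; apply: contrapT => nc; apply: nv.
  by exists v.
exact: forced_sub hV (forced_coord_dense oV).
Qed.

Lemma closure_mono_at A A' v : A `<=` A' -> closure A v -> closure A' v.
Proof. by move=> /closure_subset; apply. Qed.

(** Run the game on [Y j] for the property that the slice of [U] over [y] is
    covered: slices over a dense set of [y] are dense in [U]. *)
Lemma fillable_of_slices j U : open U ->
  (forall O, open O -> (exists2 u, U u & O (u j)) ->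
    forced (covers_slice j (U `&` [set u | O (u j)]))) ->
  fillable U.
Proof.
move=> oU hO.
pose R y A := forall v, U v -> v j = y -> closure A v.
apply: forced_sub (@forced_coordinate j R _ _) => [A /dense_setP dR v Uv|y A A' AA' h v Uv vy|O].
- apply/closure_openP => N oN Nv.
  have [|y Ry [w [Nw Uw] wy]] := dR [set y | exists2 u, (N `&` U) u & u j = y].
    split; first by apply: open_proj; exact: openI.
    by exists (v j), v.
  by have /closure_openP := Ry w Uw wy; apply.
- exact: closure_mono_at AA' (h v Uv vy).
- move=> [oO [y Oy]].
  have [[u Uu Ou]|nU] := pselect (exists2 u, U u & O (u j)); last first.
    apply: forces_true => A; exists y => // v Uv vy; case: nU; exists v => //.
    by rewrite vy.
  apply: forced_sub (hO O oO _); last by exists u.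
  move=> A [v [Uv Ov] hv]; exists (v j) => // w Uw wv; apply: hv => //.
  by split=> //=; rewrite wv.
Qed.

(** What can be forced at each single point can be forced at a dense set of
    points: run the games on the factors one inside the other. *)
Lemma forced_dense (Phi : product Y -> set (set (product Y))) :
  (forall u A A', A `<=` A' -> Phi u A -> Phi u A') ->
  (forall u, forced (Phi u)) -> forced [set A | dense_set [set u | Phi u A]].
Proof.
move=> Phi_mono hPhi.
pose Psi (s : seq J) u A := forall O : forall j, set (Y j), (forall j, nonempty_open (O j)) ->
  exists v, [/\ forall j, j \in s -> O j (v j), forall j, j \notin s -> v j = u j & Phi v A].
have hPsi s u : forced (Psi s u).
  elim: s u => [|j s IHs] u.
    apply: forced_sub (hPhi u) => A PA O _; by exists u.
  have [js|js] := boolP (j \in s).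
    apply: forced_sub (IHs u) => A h O oO; have [v [v1 v2 v3]] := h O oO.
    exists v; split=> // i; rewrite inE; first by move=> /orP[/eqP ->|]; exact: v1.
    by rewrite negb_or => /andP[_]; exact: v2.
  pose R (y : Y j) (A : set (product Y)) := Psi s (dfwith u j y : product Y) A.
  apply: forced_sub (@forced_coordinate j R _ _).
  - move=> A /dense_setP dR O oO; have [y Ry Oy] := dR (O j) (oO j).
    have [v [v1 v2 v3]] := Ry O oO; exists v; split=> // i; rewrite inE.
      by move=> /orP[/eqP ->|]; [rewrite v2 // dfwithin|exact: v1].
    by rewrite negb_or => /andP[ij iss]; rewrite v2 // dfwithout // eq_sym.
  - move=> y A A' AA' h O oO; have [v [v1 v2 v3]] := h O oO.
    by exists v; split=> //; exact: Phi_mono v3.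
  - move=> O [oO [y Oy]]; apply: forced_sub (IHs (dfwith u j y)) => A h.
    by exists y.
apply: forced_sub (hPsi es u0) => A h; apply/dense_setP => N [oN [u Nu]].
have [B [oB Bu BN]] := box_sub oN Nu.
have [|v [v1 _ v3]] := h B; first by move=> j; split=> //; exists (u j).
by exists v => //; apply: BN => j; exact: v1 (esP j).
Qed.

Definition hereditarily_unfillable W : Prop :=
  nonempty_open W /\ forall U, nonempty_open U -> U `<=` W -> ~ fillable U.

(** The union of the fillable open sets is fillable, by [forced_dense]; take the
    complement of its closure. *)
Lemma unfillable_part : ~ fillable setT -> exists W, hereditarily_unfillable W.
Proof.
move=> nfill; pose F := \bigcup_(U in [set U | open U /\ fillable U]) U.
have oF : open F by apply: bigcup_open => U [].
have fF : fillable F.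
  pose Phi u A := F u -> closure A u.
  apply: forced_sub (@forced_dense Phi _ _) => [A /dense_setP dA u Fu|u A A' AA' h Fu|u].
  - apply/closure_openP => N oN Nu.
    have [|v Pv [Nv Fv]] := dA (N `&` F); first by split; [exact: openI|exists u].
    by have /closure_openP := Pv Fv; apply.
  - exact: closure_mono_at AA' (h Fu).
  - have [[U [oU fU] Uu]|nF] := pselect (F u); last by apply: forces_true => A /nF.
    by apply: forced_sub fU => A UA _; exact: UA.
exists (~` closure F); split; first split.
- by rewrite openC; exact: closed_closure.
- apply: contrapT => nW; apply: nfill; apply: forced_sub fF => A FA u _.
  have : closure F u by apply: contrapT => ncu; apply: nW; exists u.
  move=> cu; have := closure_subset FA cu; by rewrite -(closure_id _).1 //; exact: closed_closure.
- move=> U [oU [u Uu]] UW fU; apply: (UW u Uu); apply: subset_closure.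
  by exists U.
Qed.

(** * Gluing and evasion *)

(** Outside the closure of the [W e] all points are put in, which keeps
    coordinatewise density without interfering with the [W e]. *)
Definition merge (E : Type) (W A_ : E -> set (product Y)) : set (product Y) :=
  [set u | (exists2 e, W e u & A_ e u) \/ ~ closure (\bigcup_e W e) u].

Lemma coord_dense_merge (E : Type) (W A_ : E -> set (product Y)) V :
  (forall e, open (W e)) -> (forall b, open (V b)) ->
  (forall e, coord_dense (fun b => V b `&` W e) (A_ e)) ->
  coord_dense V (merge W A_).
Proof.
move=> oW oV hA b j u Vu O oO Ou.
have [[w [Vw Ow [e _ We]]]|nw] :=
    pselect (exists w, [/\ V b w, O (w j) & (\bigcup_e W e) w]).
  have [a [Aa [Va Wa] Oa]] := hA e b j w (conj Vw We) O oO Ow.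
  by exists a; split=> //; left; exists e.
exists u; split=> //; right; apply/not_closureP.
exists (V b `&` [set v | O (v j)]); split=> //.
  by apply: openI => //; exact: open_cylinder.
by move=> w Ww [Vw Ow]; apply: nw; exists w.
Qed.

Lemma closure_merge (E : Type) (W A_ : E -> set (product Y)) e u :
  (forall e, open (W e)) -> (forall e e' v, W e v -> W e' v -> e = e') ->
  W e u -> closure (merge W A_) u -> closure (A_ e) u.
Proof.
move=> oW Wdisj Wu; rewrite !closure_openP => h N oN Nu.
have [||a [[e' We' Aa]|na] [Na Wa]] := h (N `&` W e); first exact: openI.
- by [].
- by exists a => //; rewrite (Wdisj _ _ _ Wa We').
- by case: na; apply: subset_closure; exists e.
Qed.

(** Since [U] has no fillable part, every open set of [Y j] that meets the
    projection of [U] contains an open [O] over which [U] is evasive. A maximal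
    disjoint family of such [O] is dense in the projection, and the witnesses
    for its members are glued. *)
Lemma evasive_dense W U j : hereditarily_unfillable W -> open U -> U `<=` W ->
  exists T : set (Y j), [/\ open T, dense_set T &
    evasive j (U `&` [set u | T (u j)])].
Proof.
move=> [_ hW] oU UW.
pose fam := [set O : set (Y j) | [/\ open O, exists2 u, U u & O (u j) &
  evasive j (U `&` [set u | O (u j)])]].
have [E [Efam Edisj Emax]] := ex_maximal_disjoint_subcollection (@id (set (Y j))) fam.
pose T0 := \bigcup_(O in E) O.
have oT0 : open T0 by apply: bigcup_open => O /Efam[].
have disj O O' y : E O -> E O' -> O y -> O' y -> O = O'.
  by move=> EO EO' Oy O'y; apply: Edisj => //; exists y.
(* By maximality of [E], the part of [U] over the complement of [closure T0] is
   empty: otherwise it would be fillable by slices. *)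
have UT0 u : U u -> ~ ~ closure T0 (u j).
  move=> Uu nT0.
  pose C := ~` closure T0; have oC : open C by rewrite openC; exact: closed_closure.
  have : ~ fillable (U `&` [set v | C (v j)]).
    apply: hW; first split; [|by exists u|by move=> v []; move=> /UW].
    by apply: openI => //; exact: open_cylinder.
  apply; apply: (@fillable_of_slices j); first by apply: openI => //; exact: open_cylinder.
  move=> O oO [v [Uv Cv] Ov]; apply: forced_covers_slice => ev.
  pose O2 := O `&` C.
  have fO2 : fam O2.
    split; [exact: openI|by exists v|].
    have -> : U `&` [set u | O2 (u j)] =
        (U `&` [set v | C (v j)]) `&` [set u | O (u j)]; last by [].
    by rewrite predeqE => w; split=> [[? []]|[[? ?] ?]].
  have O2T0 y : O2 y -> ~ T0 y by move=> [_ nc] /subset_closure.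
  apply: (Emax (E `|` [set O2])).
  - split; first by move=> O' ?; left.
    by move=> /(_ O2 (or_intror erefl)) EO2; apply: (O2T0 (v j)) => //; exists O2.
  - by move=> O' [/Efam//|->].
  - move=> O1 O1' [E1|->] [E1'|->] [y [/= y1 y1']] //.
    + exact: disj y1 y1'.
    + by case: (O2T0 y y1'); exists O1.
    + by case: (O2T0 y y1); exists O1'.
exists (T0 `|` ~` closure T0); split.
- by apply: openU => //; rewrite openC; exact: closed_closure.
- apply/dense_setP => N [oN [y Ny]].
  have [/closure_openP/(_ N oN Ny)[y' T0y' Ny']|ny] := pselect (closure T0 y).
    by exists y' => //; left.
  by exists y => //; right.
move=> V oV.
pose W' (O : {O | E O}) := [set u : product Y | sval O (u j)].
have oW' O : open (W' O) by apply: open_cylinder; have [] := Efam _ (svalP O).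
have W'disj O O' u : W' O u -> W' O' u -> O = O'.
  move=> h h'; have := disj _ _ _ (svalP O) (svalP O') h h'.
  case: O O' {h h'} => [O EO] [O' EO'] /= e; subst O'; congr exist.
  exact: Prop_irrelevance.
have /choice[A_ A_P] : forall O : {O | E O}, exists A,
    coord_dense (fun b => V b `&` W' O) A /\
    forall u, (U `&` W' O) u -> exists v, [/\ (U `&` W' O) v, v j = u j & ~ closure A v].
  move=> O; have [_ _ ev] := Efam _ (svalP O); apply: ev => b.
  by apply: openI => //; exact: oW'.
exists (merge W' A_); split; first by apply: coord_dense_merge => // O; exact: (A_P O).1.
move=> u [Uu Tu].
have [O EO Ou] : T0 (u j) by case: Tu => // /(UT0 u Uu).
have [v [[Uv Wv] vu nAv]] := (A_P (exist _ O EO)).2 u (conj Uu Ou).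
exists v; split=> //; first by split=> //; left; exists O.
by move=> /(@closure_merge _ _ _ (exist _ O EO) v oW' W'disj Wv).
Qed.

(** * Two reducible factors *)

Hypothesis tight : forall U, nonempty_open U -> exists V : k -> set (product Y),
  (forall b, open (V b)) /\
  forall A, coord_dense V A -> exists j, covers_slice j U A.

(** The cells [cell (b, g)] are cut out by [P b] in coordinate [j0] and [Q g] in
    coordinate [j1]. Each of the two rows must contain a cell of colour [j0],
    each of the columns [g] one of colour [j1], and each other colour must occur
    once: the colour of [(true, g)] is [j1] except that of [(true, j0)], which is
    [j0], and the colour of [(false, g)] is [g] with [j0] and [j1] exchanged.
    Each cell [cell e] is evasive in its colour over a dense open set [T e _],
    and [S i] is the intersection of these sets in coordinate [i]. The union [U]
    of the cells restricted to [box S] contradicts the tightness condition: the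
    slice of [U] that it covers has the same value of its coordinate as a point
    of a cell of that colour, where the witness of evasion leaves a point
    uncovered. *)
Lemma no_grid W (B : forall j, set (Y j)) (j0 j1 : J) (P : bool -> set (Y j0))
    (Q : J -> set (Y j1)) :
  hereditarily_unfillable W -> (forall j, nonempty_open (B j)) -> box B `<=` W ->
  j0 != j1 ->
  (forall b, nonempty_open (P b) /\ P b `<=` B j0) ->
  (forall b b' y, P b y -> P b' y -> b = b') ->
  (forall g, nonempty_open (Q g) /\ Q g `<=` B j1) ->
  (forall g g' y, Q g y -> Q g' y -> g = g') -> False.
Proof.
move=> hW oB BW j01 oP Pdisj oQ Qdisj.
pose side (e : bool * J) : forall j, set (Y j) :=
  @dfwith J (fun j => set (Y j)) (@dfwith J (fun j => set (Y j)) B j0 (P e.1)) j1 (Q e.2).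
have side1 e : side e j1 = Q e.2 by rewrite /side dfwithin.
have side0 e : side e j0 = P e.1 by rewrite /side dfwithout 1?eq_sym // dfwithin.
have sideB e j : j0 != j -> j1 != j -> side e j = B j.
  by move=> ? ?; rewrite /side dfwithout // dfwithout.
have sideP e j : nonempty_open (side e j) /\ side e j `<=` B j.
  have [<-|j1j] := eqVneq j1 j; first by rewrite side1.
  have [<-|j0j] := eqVneq j0 j; first by rewrite side0.
  rewrite sideB //; split=> //; exact: oB.
have side_open e j : open (side e j) by have [[]] := sideP e j.
pose cell e := box (side e).
have oC e : open (cell e) by exact: open_box.
have CW e : cell e `<=` W.
  by apply: subset_trans BW => u Cu j; exact: (sideP e j).2.
have Cdisj e e' u : cell e u -> cell e' u -> e = e'.
  move=> Cu Cu'; have := Cu j0; have := Cu' j0; rewrite !side0 => h' h.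
  have := Cu j1; have := Cu' j1; rewrite !side1 => l' l.
  by case: e e' h h' l l' {Cu Cu'} => [b g] [b' g'] /= h h' l l';
    rewrite (Pdisj _ _ _ h h') (Qdisj _ _ _ l l').
pose color (e : bool * J) : J :=
  if e.1 then (if e.2 == j0 then j0 else j1)
  else (if e.2 == j0 then j1 else if e.2 == j1 then j0 else e.2).
have color_onto e i : exists e', color e' = i /\ side e' i = side e i.
  have [<-|j0i] := eqVneq j0 i.
    exists (e.1, if e.1 then j0 else j1); split; last by rewrite !side0.
    by rewrite /color /=; case: (e.1); [rewrite eqxx|rewrite eq_sym (negbTE j01) eqxx].
  have [<-|j1i] := eqVneq j1 i.
    exists (e.2 != j0, e.2); split; last by rewrite !side1.
    by rewrite /color /=; case: eqP.
  exists (false, i); split; last by rewrite !sideB.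
  by rewrite /color /= eq_sym (negbTE j0i) eq_sym (negbTE j1i).
have hT e i := cid (evasive_dense i hW (oC e) (CW e)).
pose T e i : set (Y i) := sval (hT e i).
have TP e i : [/\ open (T e i), dense_set (T e i) &
    evasive i (cell e `&` [set u | T e i (u i)])] := svalP (hT e i).
pose cells := [seq (b, g) | b <- [:: true; false], g <- es].
have cellsP e : e \in cells.
  by case: e => b g; apply/allpairsP; exists (b, g); split=> //; case: b.
pose S i : set (Y i) := [set y | forall e, e \in cells -> T e i y].
have oS i : open (S i) by apply: open_all_in => e; have [] := TP e i.
have dS i : dense_set (S i) by apply: dense_all_in => e; have [] := TP e i.
pose U := (\bigcup_e cell e) `&` box S.
have nU : nonempty_open U.
  split; first by apply: openI; [exact: bigcup_open|exact: open_box].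
  have hu i : exists2 y, S i y & side (true, j0) i y.
    by have /dense_setP := dS i; apply; have [] := sideP (true, j0) i.
  exists (fun i => sval (cid2 (hu i))); split.
    by exists (true, j0) => // i; case: cid2.
  by move=> i; case: cid2.
have [V [oV hV]] := tight nU.
have /choice[A_ A_P] : forall e, exists A, coord_dense (fun b => V b `&` cell e) A /\
    forall u, (cell e `&` [set v : product Y | T e (color e) (v (color e))]) u ->
      exists v, [/\ (cell e `&` [set v : product Y | T e (color e) (v (color e))]) v,
        v (color e) = u (color e) & ~ closure A v].
  by move=> e; have [_ _] := TP e (color e); apply => b; exact: openI.
have [i [u [[e0 _ Cu] Su] hu]] := hV _ (coord_dense_merge oC oV (fun e => (A_P e).1)).
have [e [ei side_e]] := color_onto e0 i; subst i.
(* Move the point [u] to the cell [e] of the colour in question, keeping its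
   coordinate of that colour. *)
have [q Cq] : exists q, cell e q.
  have hq j : exists y, side e j y by have [[_ ?]] := sideP e j.
  by exists (fun j => sval (cid (hq j))) => j; case: cid.
pose u' : product Y := dfwith q (color e) (u (color e)).
have u'e : u' (color e) = u (color e) by rewrite /u' dfwithin.
have Cu' : cell e u'.
  move=> j; have [<-|ne] := eqVneq (color e) j; last by rewrite /u' dfwithout.
  by rewrite u'e side_e; exact: Cu.
have Tu : T e (color e) (u (color e)) by apply: (Su (color e)).
have [|v [[Cv Tv] vu nAv]] := (A_P e).2 u'; first by split=> //=; rewrite u'e.
have /not_closureP[N [oN Nv NA]] : ~ closure (merge cell A_) v.
  by move=> /(closure_merge oC Cdisj Cv).
have [O [oO Ov ON]] := box_sub oN Nv.
(* The uncovered point [v] need not lie in the dense set [box S]; near it there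
   is one that does, with the same coordinate. *)
have hw j : exists y, [/\ O j y, side e j y, S j y & color e = j -> y = u' j].
  have [ej|ne] := eqVneq (color e) j.
    subst j; exists (v (color e)); split=> //; rewrite vu u'e; exact: Su.
  have [|y Sy [Oy sy]] := (dense_setP _).1 (dS j) (O j `&` side e j).
    by split; [apply: openI|exists (v j); split; [exact: Ov|exact: Cv]].
  by exists y; split=> // ej; rewrite ej eqxx in ne.
pose w : product Y := fun j => sval (cid (hw j)).
have wP j : [/\ O j (w j), side e j (w j), S j (w j) & color e = j -> w j = u' j].
  exact: svalP (cid (hw j)).
have /closure_openP/(_ N oN)[|a Aa Na] : closure (merge cell A_) w.
  apply: hu; last by have [_ _ _ ->] := wP (color e).
  by split; [exists e => // j|move=> j]; have [] := wP j.
- by apply: ON => j; have [] := wP j.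
- exact: NA Aa Na.
Qed.
(** * At most one reducible factor *)

Definition irreducible (T : topologicalType) (B : set T) : Prop :=
  forall O O', open O -> open O' -> (exists2 y, B y & O y) ->
    (exists2 y, B y & O' y) -> exists y, [/\ B y, O y & O' y].

(** To fill [box B], it is enough to force, for each open [O] in coordinate [j],
    that the slice over some [y] in [O] is covered ([Q]). Fix [O], and run the
    games on the irreducible factors one inside the other: given positions [X]
    in all of them, tightness covers a slice of the box with sides [O] and
    [B i `&` X i]. If it is a slice in coordinate [j], then irreducibility extends
    it to a slice of [box B], which is [Q]. If it is a slice in another
    coordinate [i], then irreducibility frees it from the positions [X] in the
    other coordinates ([K]), so it is an answer in the game on factor [i]. When
    one of these games is over, the part of [box B] over [O] is covered, which
    again gives [Q]. In [rest s X], the games on the factors in [s] have been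
    run, and those on the others stand at the positions [X]. *)
Lemma no_irreducible_box W (B : forall j, set (Y j)) (j : J) :
  hereditarily_unfillable W -> (forall i, nonempty_open (B i)) -> box B `<=` W ->
  (forall i, i != j -> irreducible (B i)) -> False.
Proof.
move=> [_ hW] oB BW irrB.
have oBox : open (box B) by apply: open_box => i; have [] := oB i.
apply: (hW (box B)) => //.
  have hu i : exists y, B i y by have [] := oB i.
  by split=> //; exists (fun i => sval (cid (hu i))) => i; case: cid.
pose R y A := forall v, box B v -> v j = y -> closure A v.
have R_mono y A A' : A `<=` A' -> R y A -> R y A'.
  by move=> AA' h v Bv vy; exact: closure_mono_at AA' (h v Bv vy).
have near_dense i (K : Y i -> set (product Y) -> Prop) A (O : set (Y j)) :
    open O -> dense_set [set y | K y A] ->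
    (forall y, K y A -> forall v, box B v -> O (v j) -> v i = y -> closure A v) ->
    forall v, box B v -> O (v j) -> closure A v.
  move=> oO /dense_setP dK hK v Bv Ov; apply/closure_openP => N oN Nv.
  pose M := N `&` (box B `&` [set u | O (u j)]).
  have oM : open M by apply: openI => //; apply: openI => //; exact: open_cylinder.
  have [|y Ky [w [Nw [Bw Ow]] wy]] := dK [set y | exists2 u, M u & u i = y].
    by split; [exact: open_proj|exists (v i), v].
  by have /closure_openP := hK y Ky w Bw Ow wy; apply.
apply: forced_sub (@forced_coordinate j R R_mono _) => [A dR v Bv|O oO].
  by apply: (near_dense j R A setT openT dR) => // y Ry w Bw _; exact: Ry.
have [[y1 By1 Oy1]|nBO] := pselect (exists2 y, B j y & O y); last first.
  have [_ [y Oy]] := oO; apply: forces_true => A; exists y => // v Bv vy.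
  by case: nBO; exists y => //; rewrite -vy; exact: Bv.
pose Q A := exists2 y, O y & R y A.
pose K i y A := forall v, box B v -> O (v j) -> v i = y -> closure A v.
have Q_mono A A' : A `<=` A' -> Q A -> Q A'.
  by move=> AA' [y Oy /(R_mono _ _ _ AA') Ry]; exists y.
have K_mono i y A A' : A `<=` A' -> K i y A -> K i y A'.
  by move=> AA' h v Bv Ov vy; exact: closure_mono_at AA' (h v Bv Ov vy).
pose rest (s : seq J) (X : forall i, set (Y i)) A :=
  [\/ Q A, exists2 i, i \in s & dense_set [set y | K i y A] |
    exists i, [/\ i \notin s, i != j & exists y, [/\ X i y, B i y & K i y A]]].
have inner s (X : forall i, set (Y i)) :
    (forall i, open (X i)) -> (forall i, exists2 y, B i y & X i y) ->
    forced (rest s X).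
  elim: s X => [|i s IHs] X oX BX.
    pose U := box B `&` ([set u | O (u j)] `&`
      [set u : product Y | forall i, i \in [seq i <- es | i != j] -> X i (u i)]).
    have UP u : U u <-> [/\ box B u, O (u j) & forall i, i != j -> X i (u i)].
      split=> [[Bu [Ou Xu]]|[Bu Ou Xu]].
        by split=> // i ij; apply: Xu; rewrite mem_filter ij esP.
      by split=> //; split=> // i; rewrite mem_filter => /andP[/Xu].
    have oU : open U.
      apply: openI => //; apply: openI; first by apply: open_cylinder; have [] := oO.
      by apply: open_all_in => i; exact: open_cylinder.
    have nU : nonempty_open U.
      split=> //.
      pose O' := @dfwith J (fun i => set (Y i)) (fun=> setT) j O.
      have hu i : exists y, [/\ B i y, i != j -> X i y & O' i y].
        have [ij|ij] := eqVneq i j.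
          by subst i; exists y1; split=> //; rewrite /O' dfwithin.
        have [y By Xy] := BX i; exists y; split=> //.
        by rewrite /O' dfwithout // eq_sym.
      exists (fun i => sval (cid (hu i))); apply/UP; split=> [i||i ij].
      - by case: cid => y [].
      - by case: cid => y /= [_ _]; rewrite /O' dfwithin.
      - by case: cid => y /= [_ h _]; exact: h.
    have [V [oV hV]] := tight nU.
    apply: forced_sub (forced_coord_dense oV) => A cA.
    have [i [u /UP[Bu Ou Xu] hu]] := hV A cA.
    (* Irreducibility: a point [v] of the larger slice is approximated by points
       of the slice of [U], moved in the coordinates other than [i] and [j]. *)
    have hK v : box B v -> O (v j) -> v i = u i -> closure A v.
      move=> Bv Ov vu; apply/closure_openP => N oN Nv.
      have [G [oG Gv GN]] := box_sub oN Nv.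
      have hw l : exists y, [/\ B l y, G l y, l != j -> X l y & l = j \/ l = i -> y = v l].
        have [lij|nlij] := pselect (l = j \/ l = i).
          exists (v l); split=> // lj; case: lij => [e|e]; first by rewrite e eqxx in lj.
          by subst l; rewrite vu; exact: Xu.
        have lj : l != j by apply/eqP => e; apply: nlij; left.
        have [|//|y [By Gy Xy]] := irrB l lj _ _ (oG l) (oX l); first by exists (v l).
        by exists y; split.
      pose w : product Y := fun l => sval (cid (hw l)).
      have wP l : [/\ B l (w l), G l (w l), l != j -> X l (w l) & l = j \/ l = i -> w l = v l].
        exact: svalP (cid (hw l)).
      have : closure A w.
        apply: hu; last by have [_ _ _ ->] := wP i; [|right].
        apply/UP; split=> [l||l lj]; first by have [] := wP l.
        + by have [_ _ _ ->] := wP j; [|left].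
        + by have [_ _ + _] := wP l; apply.
      by move=> /closure_openP; apply => //; apply: GN => l; have [] := wP l.
    have [ij|ij] := eqVneq i j.
      subst i; constructor 1; exists (u j) => // v Bv vu.
      by apply: hK => //; rewrite vu.
    constructor 3; exists i; split=> //; exists (u i); split=> //; first exact: Xu.
  pose K' y A := K i y A \/ rest (i :: s) X A.
  apply: forced_sub (@forced_coordinate i K' _ _) => [A dK'|y A A' AA'|O' [oO' [y O'y]]].
  - have [//|nr] := pselect (rest (i :: s) X A).
    constructor 2; exists i; first by rewrite inE eqxx.
    by apply: dense_set_mono dK' => y [].
  - move=> [/(K_mono _ _ _ _ AA')|[/(Q_mono _ _ AA')|[l ls dl]|[l [ls lj [x [Xx Bx Kx]]]]]].
    + by left.
    + by right; constructor 1.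
    + right; constructor 2; exists l => //; apply: dense_set_mono dl => x.
      exact: K_mono.
    + right; constructor 3; exists l; split=> //; exists x; split=> //.
      exact: K_mono Kx.
  - have [[z Bz O'z]|nBO'] := pselect (exists2 z, B i z & O' z); last first.
      apply: forces_true => A; exists y => //; left=> v Bv _ vy.
      by case: nBO'; exists y => //; rewrite -vy; exact: Bv.
    pose X' := @dfwith J (fun i => set (Y i)) X i O'.
    have X'i : X' i = O' by rewrite /X' dfwithin.
    have X'l l : l != i -> X' l = X l by move=> li; rewrite /X' dfwithout // eq_sym.
    apply: forced_sub (IHs X' _ _) => [A|l|l]; last 2 first.
    + by have [->|li] := eqVneq l i; [rewrite X'i|rewrite X'l].
    + by have [->|li] := eqVneq l i; [rewrite X'i; exists z|rewrite X'l].
    move=> [QA|[l ls dl]|[l [ls lj [x [Xx Bx Kx]]]]].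
    + by exists y => //; right; constructor 1.
    + by exists y => //; right; constructor 2; exists l => //; rewrite inE ls orbT.
    + have [e|li] := eqVneq l i.
        by subst l; exists x; [rewrite -X'i|left].
      exists y => //; right; constructor 3; exists l; split=> //.
        by rewrite inE (negbTE li).
      by exists x; split=> //; rewrite -X'l.
have oX i : open (setT : set (Y i)) by exact: openT.
apply: forced_sub (inner es (fun=> setT) oX _) => [A|i]; last first.
  by have [_ [y By]] := oB i; exists y.
move=> [//|[i _ dK]|[i [+ _ _]]]; last by rewrite esP.
exists y1 => // v Bv vy; apply: (near_dense i (K i) A O _ dK) => //.
- by have [] := oO.
- by rewrite vy.
Qed.

(** Split [B] into two disjoint open parts, keep one of them and split the other
    one again. *)
Lemma disjoint_opens (T : topologicalType) (B : set T) : nonempty_open B ->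
  (forall O, nonempty_open O -> O `<=` B -> ~ irreducible O) ->
  exists D : nat -> set T, (forall n, nonempty_open (D n) /\ D n `<=` B) /\
    forall m n y, D m y -> D n y -> m = n.
Proof.
move=> oB nirr.
have /choice[h hP] : forall C : set T, exists p : set T * set T,
    nonempty_open C -> C `<=` B ->
    [/\ nonempty_open p.1, nonempty_open p.2, p.1 `<=` C, p.2 `<=` C &
      forall y, p.1 y -> ~ p.2 y].
  move=> C; have [[oC CB]|nC] := pselect (nonempty_open C /\ C `<=` B); last first.
    by exists (setT, setT) => oC CB; case: nC.
  have [p pP] : exists p : set T * set T, [/\ open p.1, open p.2,
      exists2 y, C y & p.1 y, exists2 y, C y & p.2 y & ~ exists y, [/\ C y, p.1 y & p.2 y]].
    apply: contrapT => np; apply: (nirr C oC CB) => O O' oO oO' CO CO'.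
    by apply: contrapT => ny; apply: np; exists (O, O').
  case: pP => o1 o2 [y1 Cy1 p1] [y2 Cy2 p2] np.
  exists (C `&` p.1, C `&` p.2) => _ _; split=> /=.
  - by split; [apply: openI => //; case: oC|exists y1].
  - by split; [apply: openI => //; case: oC|exists y2].
  - by move=> ? [].
  - by move=> ? [].
  - by move=> y [Cy y1'] [_ y2']; apply: np; exists y.
pose C := fix C n := if n is m.+1 then (h (C m)).2 else B.
have CP n : nonempty_open (C n) /\ C n `<=` B.
  elim: n => [|n [oCn CnB]] /=; first by split.
  have [_ o2 _ C2 _] := hP _ oCn CnB.
  by split=> //; exact: subset_trans CnB.
have Csub m n : (m <= n)%N -> C n `<=` C m.
  elim: n => [|n IHn]; first by rewrite leqn0 => /eqP ->.
  rewrite leq_eqVlt ltnS => /orP[/eqP ->//|/IHn]; apply: subset_trans.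
  by have [_ _ _ + _] := hP _ (CP n).1 (CP n).2.
have Cdisj m n y : (m < n)%N -> (h (C m)).1 y -> ~ (h (C n)).1 y.
  move=> mn hm hn; have [_ _ _ _ dj] := hP _ (CP m).1 (CP m).2.
  apply: (dj y hm); apply: (Csub m.+1 n mn).
  by have [_ _ + _ _] := hP _ (CP n).1 (CP n).2; apply.
exists (fun n => (h (C n)).1); split=> [n|m n y hm hn].
  have [o1 _ s1 _ _] := hP _ (CP n).1 (CP n).2.
  by split=> //; apply: subset_trans (CP n).2.
by have [/Cdisj/(_ hm)|/Cdisj/(_ hn)|//] := ltngtP m n.
Qed.

(** The two cases depend on how many factors of a box in the unfillable part
    contain no irreducible open set. If there is at most one, the others are
    shrunk to irreducible sets; if there is none, [j] serves as the exceptional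
    coordinate. *)
Lemma finite_product_fillable (j : J) : fillable setT.
Proof.
apply: contrapT => /unfillable_part[W hW].
have [[oW [u Wu]] _] := hW.
have [B [oB Bu BW]] := box_sub oW Wu.
have nB i : nonempty_open (B i) by split=> //; exists (u i).
pose bad i := forall O, nonempty_open O -> O `<=` B i -> ~ irreducible O.
have [[j0 [j1 [j01 bad0 bad1]]]|nbad] :=
    pselect (exists j0 j1, [/\ j0 != j1, bad j0 & bad j1]).
  have [P [PB Pdisj]] := disjoint_opens (nB j0) bad0.
  have [Q [QB Qdisj]] := disjoint_opens (nB j1) bad1.
  apply: (@no_grid W B j0 j1 (fun b => P b) (fun g => Q (index g es)) hW nB BW j01) => //.
  - by move=> b b' y hb hb'; have := Pdisj _ _ _ hb hb'; case: b b' {hb hb'} => -[].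
  - move=> g g' y hg hg'; have e := Qdisj _ _ _ hg hg'.
    by rewrite -(nth_index g (esP g)) e nth_index.
have [j' j'P] : exists j', forall i, i != j' -> ~ bad i.
  have [[j' bj']|nb] := pselect (exists i, bad i).
    by exists j' => i ij' bi; apply: nbad; exists i, j'.
  by exists j => i _ bi; apply: nb; exists i.
have hB' i : exists O, [/\ nonempty_open O, O `<=` B i & i != j' -> irreducible O].
  have [ij|ij] := eqVneq i j'; first by exists (B i); split=> //; rewrite ij eqxx.
  apply: contrapT => nO; apply: (j'P i ij) => O oO OB irr.
  by apply: nO; exists O.
pose B' i := sval (cid (hB' i)).
have B'P i : [/\ nonempty_open (B' i), B' i `<=` B i & i != j' -> irreducible (B' i)].
  exact: svalP (cid (hB' i)).
apply: (@no_irreducible_box W B' j' hW).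
- by move=> i; have [] := B'P i.
- by apply: subset_trans BW => v B'v i; have [_ + _] := B'P i; apply; exact: B'v.
- by move=> i ij; have [_ _] := B'P i; apply.
Qed.

End FiniteProduct.
(** * The full product *)

(** Quantifying over one entry at a time avoids counting the finite sequences. *)
Lemma forces_all_tuples (k : cardinal) (theta : ordnum) (Z : topologicalType) (I : Type)
    (n : nat) (Phi : seq I -> set (set Z)) :
  infinite_cardinal k -> is_succ_card k theta -> [set: I] #<= [set: k] ->
  (forall s A B, A `<=` B -> Phi s A -> Phi s B) ->
  (forall s, size s = n -> forces theta (Phi s)) ->
  forces theta [set A | forall s, size s = n -> Phi s A].
Proof.
move=> ki thetaS Ik; elim: n Phi => [|n IHn] Phi mono hPhi.
  by apply: forces_sub (hPhi [::] erefl) => A PA [].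
apply: forces_sub (@forces_all _ _ ki thetaS Z I
  (fun i A => forall s, size s = n -> Phi (i :: s) A) Ik _ _).
- by move=> A h [//|i s] [ss]; exact: h.
- by move=> i A B AB h s ss; exact: mono AB (h s ss).
- move=> i; apply: (IHn (fun s => Phi (i :: s))) => [s A B|s ss]; first exact: mono.
  by apply: hPhi => /=; rewrite ss.
Qed.

Lemma finite_enum (I : Type) (G : set I) : finite_set G ->
  exists es : seq {classic G}, forall g, g \in es.
Proof.
move=> Gf; have /finite_seqP[es esE] : finite_set [set: {classic G}].
  by have : [set: {classic G}] #= G := card_setT G; move=> /eq_finite_set ->.
by exists es => g; have : [set: {classic G}] g by []; rewrite esE.
Qed.

Section FiniteSubproduct.
Variables (k : cardinal) (theta : ordnum) (I : Type) (X : I -> topologicalType).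
Hypothesis k_inf : infinite_cardinal k.
Hypothesis thetaS : is_succ_card k theta.
Hypothesis gdX : forall i : I, gd_le (X i) k.
Hypothesis tight : tightness_condition k X.
Variable z0 : product X.

Definition restriction (G : set I) (z : product X) : subproduct X G :=
  fun g => z (set_val g).

Lemma restriction_surj (G : set I) (u : subproduct X G) : exists z, @restriction G z = u.
Proof.
exists (fun i => if pselect (exists g : G, set_val g = i) is left h
  then let: exist g e := cid h in ecast i (X i) e (u g) else z0 i).
apply: functional_extensionality_dep => g; rewrite /restriction.
case: pselect => [h|]; last by case; exists g.
case: (cid h) => g' e; have eg : g' = g by exact: val_inj.
by subst g'; rewrite (Prop_irrelevance e erefl).
Qed.

Lemma restriction_continuous (G : set I) (U : set (subproduct X G)) :
  open U -> open (@restriction G @^-1` U).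
Proof.
move=> oU; rewrite openE => z Uz.
have [H [B [Hf Bz BU]]] := box_nbhs oU Uz.
have [s HE] := (@finite_seqP {classic G} H).1 Hf.
rewrite /interior nbhsE.
exists [set w : product X | forall g : {classic G}, g \in s -> B g (w (set_val (g : G)))].
  split; last by move=> g _; exact: (Bz g).2.
  by apply: open_all_in => g; apply: open_cylinder; exact: (Bz g).1.
by move=> w hw; apply: BU => g; rewrite HE; exact: hw.
Qed.

Lemma forces_dense_subproduct (G : set I) : finite_set G -> G !=set0 ->
  forces theta [set A | closure (@restriction G @` A) = [set: subproduct X G]].
Proof.
move=> Gf G0; pose J : choiceType := {classic G}.
have [es esP] := finite_enum Gf.
have [i0 Gi0] := G0; pose g0 : J := SigSub (mem_set Gi0).
pose Y (g : J) := X (set_val (g : G)).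
apply: forces_sub (@finite_product_fillable k theta k_inf thetaS J es Y _ _
  (@restriction G z0) _ (@restriction G) _ _ _ g0).
- by move=> A h /=; rewrite -subTset.
- exact: esP.
- by move=> j; exact: gd_le_winnable (gdX _).
- exact: restriction_continuous.
- exact: restriction_surj.
- move=> U [oU nU]; have [V [oV hV]] := tight Gf G0 oU nU.
  exists V; split=> // A cA; have [|g [sub nsub]] := hV A.
    move=> b g; rewrite eqEsubset; split.
      by apply: closure_subset => y [u [_ Vu] <-]; exists u.
    apply: (@subset_trans _ (closure (closure (proj g @` (A `&` V b))))).
      apply: closure_subset => y [u Vu <-]; apply/closure_openP => O oO Ou.
      have [a [Aa Va Oa]] := cA b g u Vu O oO Ou.
      by exists (proj g a) => //; exists a.
    by rewrite -(closure_id _).1 //; exact: closed_closure.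
  exists g; apply: contrapT => ncov; apply: nsub => y [u Uu uy].
  apply: contrapT => nuy; apply: ncov; exists u => // v Uv vu.
  apply: contrapT => ncv; apply: nuy; exists v => //.
  by rewrite -uy.
Qed.

Hypothesis I_le_k : [set: I] #<= [set: k].

(** A basic open set restricts finitely many coordinates, listed by some [s], so
    density means that [Phi s] holds for all [s]. *)
Lemma forces_dense_product : forces theta (@dense_set (product X)).
Proof.
pose Phi (s : seq {classic I}) (A : set (product X)) :=
  forall (z : product X) (O : forall i, set (X i)),
    (forall i, open (O i) /\ O i (z i)) ->
    exists2 a, A a & forall i : {classic I}, i \in s -> O i (a i).
have Phi_mono s A B : A `<=` B -> Phi s A -> Phi s B.
  by move=> AB h z O zO; have [a /AB Ba Oa] := h z O zO; exists a.
have hPhi s : forces theta (Phi s).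
  pose G : set I := [set i | (i : {classic I}) \in s].
  have [[i Gi]|G0] := pselect (G !=set0); last first.
    apply: forces_sub (@forces_hit _ _ k_inf thetaS (product X) setT _).
      move=> A [a [Aa _]] z O _; exists a => // i si.
      by case: G0; exists i.
    by split; [exact: openT|exists z0].
  have Gf : finite_set G by exact: (@finite_seq {classic I}).
  have [es esP] := finite_enum Gf.
  apply: forces_sub (forces_dense_subproduct Gf (ex_intro _ i Gi)) => A dA z O zO.
  pose N : set (subproduct X G) :=
    [set u | forall g : {classic G}, g \in es -> O (set_val (g : G)) (u g)].
  have oN : open N.
    by apply: open_all_in => g; apply: open_cylinder; exact: (zO _).1.
  have : closure (@restriction G @` A) (@restriction G z) by rewrite dA.
  move=> /closure_openP/(_ N oN)[g _|_ [a Aa <-] Na]; first exact: (zO _).2.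
  exists a => // l ls; have Gl : G l by [].
  exact: (Na (SigSub (mem_set Gl)) (esP _)).
have Phi_all : forces theta [set A | forall n s, size s = n -> Phi s A].
  apply: (@forces_all _ _ k_inf thetaS (product X) nat
    (fun n => [set A | forall s, size s = n -> Phi s A])).
  - exact: (infiniteP _).1 k_inf.
  - by move=> n A B AB h s ss; exact: Phi_mono AB (h s ss).
  - move=> n; exact: (forces_all_tuples k_inf thetaS I_le_k Phi_mono).
apply: forces_sub Phi_all => A hA; apply/dense_setP => N [oN [z Nz]].
have [G [O [Gf zO ON]]] := box_nbhs oN Nz.
have [s GE] := (@finite_seqP {classic I} G).1 Gf.
have [a Aa Oa] := hA (size s) s erefl z O zO.
by exists a => //; apply: ON => i; rewrite GE; exact: Oa.
Qed.

End FiniteSubproduct.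

Theorem theorem2p7 (k : cardinal) (I : Type) (X : I -> topologicalType)
    (k_infinite : infinite_cardinal k)
    (I_le_k : card_leq I k)
    (gdX : forall i : I, gd_le (X i) k)
    (tight : tightness_condition k X) :
  gd_le (product X) k.
Proof.
apply: winsI_succ_gd_le => //.
have [theta thetaS] := succ_card_exists k.
apply: (forces_winsI k_infinite thetaS).
(* On an empty product the game ends at stage 0. *)
have [[z0 _]|nz] := pselect (exists z : product X, True).
  exact: (forces_dense_product k_infinite thetaS gdX tight z0 I_le_k).
apply: forces_true => A; rewrite /dense_set predeqE => z.
by case: nz; exists z.
Qed.
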